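(* Let $X$ be an affine complex variety and $f: X(\mathbb{C})\to \mathbb{C}$ be a continuous function for the Euclidean topology. Suppose there exists a polynomial $P\in \mathbb{C}[X][t]$ which is non-zero on each irreducible component of $X(\mathbb{C})$ (that is, for each irreducible component $X_i$ of $X$, the polynomial in $\mathbb{C}[X_i][t]$ obtained by restricting the coefficients of $P$ to $X_i$ is non-zero) and such that $$\forall x\in X(\mathbb{C}),\quad P(x,f(x))=0.$$ Then $f \in \mathcal{K}^0(X(\mathbb{C}))$.
   Context: An affine complex variety is $X=\operatorname{Spec}(\mathbb{C}[X])$ with $\mathbb{C}[X]$ a reduced finitely generated $\mathbb{C}$-algebra ($X$ need not be irreducible). $X(\mathbb{C})$ is the set of closed points of $X$, identified with a Zariski closed subset of some $\mathbb{C}^n$; elements of $\mathbb{C}[X]$ are identified with polynomial functions on $X(\mathbb{C})$. A function $f:X(\mathbb{C})\to\mathbb{C}$ is rational if it is regular on some Zariski dense Zariski open subset of $X(\mathbb{C})$. $\mathcal{K}^0(X(\mathbb{C}))$ is the ring of functions $f:X(\mathbb{C})\to\mathbb{C}$ that are rational and continuous on all of $X(\mathbb{C})$ for the Euclidean topology. For $P\in\mathbb{C}[X][t]$, $P(x,s)$ denotes the value at $s\in\mathbb{C}$ of the polynomial obtained by evaluating the coefficients of $P$ at $x$. *)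

(* Defs.v *)
From mathcomp Require Import all_boot all_order all_algebra.
From mathcomp Require Import all_classical all_reals all_analysis.
From mathcomp Require Import complex.
(* Only the canonical structures: the notations of mpoly clash with those of
   MathComp-Analysis. *)
From mathcomp Require mpoly.
Import (canonicals) mpoly.

Set Implicit Arguments.
Unset Strict Implicit.
Unset Printing Implicit Defensive.

Import Order.TTheory GRing.Theory Num.Theory.
Import numFieldNormedType.Exports.

Local Open Scope classical_set_scope.
Local Open Scope ring_scope.

(* The bare type R[i] carries no topology; packaged as a numClosedFieldType it
   inherits the one of its norm |a + ib| = sqrt (a^2 + b^2), so that
   'rV[CC R]_n has the Euclidean topology of C^n. *)
Definition CC (R : realType) : numClosedFieldType := R[i].

Notation Cpoly R n := (mpoly.mpoly n (CC R)).

Section ZariskiGeometry.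
Variables (R : realType) (n : nat).
Local Notation C := (CC R).
Local Notation point := 'rV[C]_n.
Local Notation poly_fun := (Cpoly R n).

Definition ev (p : poly_fun) (x : point) : C := mpoly.meval (x ord0) p.

Definition zero_locus (S : set poly_fun) : set point :=
  [set x | forall p, S p -> ev p x = 0].

Definition vanishing_ideal (Z : set point) : set poly_fun :=
  [set p | forall x, Z x -> ev p x = 0].

Definition zariski_closed (Z : set point) : Prop :=
  exists S : set poly_fun, Z = zero_locus S.

Definition zariski_open_in (X U : set point) : Prop :=
  exists2 Z, zariski_closed Z & U = X `\` Z.

Definition zariski_dense_in (X U : set point) : Prop :=
  forall Z, zariski_closed Z -> U `<=` Z -> X `<=` Z.

Definition zariski_irreducible (Z : set point) : Prop :=
  Z !=set0 /\
  forall A B, zariski_closed A -> zariski_closed B ->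
    Z `<=` A `|` B -> Z `<=` A \/ Z `<=` B.

(* A maximal irreducible subset is automatically closed in X. *)
Definition irreducible_component (X Z : set point) : Prop :=
  [/\ Z `<=` X, zariski_irreducible Z
    & forall Z', Z' `<=` X -> zariski_irreducible Z' -> Z `<=` Z' -> Z' = Z].

(* A function on X(C) is represented by a function on C^n of which only the
   values on X matter, and an element of C[X] = C[x_1..x_n] / I(X) by any of
   its lifts to C[x_1..x_n]. *)

Definition regular_on (X U : set point) (f : point -> C) : Prop :=
  forall x, U x -> exists V, exists p q : poly_fun,
    [/\ zariski_open_in X V, V x, V `<=` U
      & forall y, V y -> ev q y != 0 /\ f y = ev p y / ev q y].

Definition rational_function (X : set point) (f : point -> C) : Prop :=
  exists U, [/\ zariski_open_in X U, zariski_dense_in X U & regular_on X U f].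

Definition K0 (X : set point) : set (point -> C) :=
  [set f | rational_function X f /\ {within X, continuous f}].

(* The image of P in C[Z][t] is nonzero. *)
Definition nonzero_restriction (Z : set point) (P : {poly poly_fun}) : Prop :=
  exists k : nat, ~ vanishing_ideal Z P`_k.

Definition eval_at (P : {poly poly_fun}) (x : point) (s : C) : C :=
  (map_poly (ev^~ x) P).[s].

End ZariskiGeometry.

(* Main.v *)
(** A continuous algebraic function on an irreducible variety Z in C^n is shown
    to be generically rational by induction on n, projecting Z to C^(n-1).
    - If the last coordinate y is transcendental over the projection, Z is a
      cylinder Z' x C.  On each line the function is continuous, algebraic and
      integral over C[y], hence a polynomial of bounded degree by the
      one-variable case, and Lagrange interpolation at constant values of y
      reduces to Z'.
    - If y is algebraic with minimal polynomial Q, the generic fibres are the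
      sets of (simple) roots of Q, and f is recovered from the sums of f * w over
      the fibres, w polynomial, which are continuous (continuity of roots) and
      integral over the projection, hence rational by induction.
    The one-variable case avoids holomorphy.  A bounded continuous algebraic f is
    constant: away from a finite set its image is open and closed by continuity
    of roots, and a punctured plane is connected.  A function of polynomial growth
    is reduced to a bounded one by iterated difference quotients.
    For a reducible X, Noetherianity gives, inside any nonempty Zariski open
    subset of X, a nonempty open piece of a single irreducible component. *)

From HB Require Import structures.
Require Import Defs.
From mathcomp Require Import all_boot all_order all_algebra.
From mathcomp Require Import all_classical all_reals all_analysis.
From mathcomp Require Import complex.
From mathcomp Require Import separable polyXY qpoly ring.
From mathcomp Require mpoly.
Import (canonicals) mpoly.

Set Implicit Arguments.
Unset Strict Implicit.
Unset Printing Implicit Defensive.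

Import Order.TTheory GRing.Theory Num.Theory.
Import numFieldNormedType.Exports.

Local Open Scope classical_set_scope.
Local Open Scope ring_scope.

(** * Continuity of roots *)

(** The inductive statement is shaped by what survives slicing and taking traces. Traces are
    continuous only over points with a well-behaved fibre, so continuity and the equation are
    required only where some [h] is nonzero, and the conclusion is only generic. Once the zeros of
    [h] are removed, continuity no longer excludes poles such as [1 / h]; a monic equation does, and
    it bounds the degree in [y] uniformly over the base. A general [P] is brought to this form by
    multiplying [f] by the top coefficient of [P] that survives on the component. Traces determine
    [f] by Lagrange interpolation in the fibre: at a root [y'] of [Q], the quotient
    [Q(T) / (T - y')] vanishes at the other roots and equals [Q'(y')] at [y'], and a Bezout relation
    inverts [Q'] up to an element of the base ring. The induction step forms neither quotient rings
    nor fraction fields: equality modulo an ideal becomes vanishing on a set, and Euclidean division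
    becomes pseudo-division. *)

Lemma closed_poly_splits (C : closedFieldType) (p : {poly C}) :
  exists r : seq C, p = lead_coef p *: \prod_(z <- r) ('X - z%:P).
Proof.
have [r ->] := closed_field_poly_normal p; exists r.
by rewrite {1}lead_coefZ lead_coef_prod_XsubC mulr1.
Qed.

(** A Cauchy bound: isolate the leading term in [p.[z] = 0], and divide by the power [n.-1] of [z],
    which dominates all lower powers when [1 < |z|]. *)
Lemma root_norm_le (C : numFieldType) (p : {poly C}) (z : C) :
  p != 0 -> root p z ->
  `|z| <= 1 \/ `|z| <= \sum_(i < (size p).-1) `|p`_i| / `|p`_(size p).-1|.
Proof.
move=> p0 pz; set n := (size p).-1.
have sp : size p = n.+1 by rewrite /n prednK// size_poly_gt0.
have l0 : 0 < `|p`_n| by rewrite normr_gt0 -lead_coefE lead_coef_eq0.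
have [z1|z1] : `|z| <= 1 \/ 1 < `|z|.
  by have [] := real_leP (normr_real z) (@real1 C); [left|right].
  by left.
right; have z0 : 0 < `|z| by rewrite (lt_trans ltr01).
have n0 : (0 < n)%N.
  rewrite lt0n; apply/eqP => n0; have := rootP pz.
  by rewrite horner_coef sp n0 big_ord1 expr0 mulr1 => p00; move: l0; rewrite n0 p00 normr0 ltxx.
rewrite -mulr_suml ler_pdivlMr// -(ler_pM2r (exprn_gt0 n.-1 z0)).
have -> : `|z| * `|p`_n| * `|z| ^+ n.-1 = `|p`_n * z ^+ n|.
  by rewrite normrM normrX mulrAC -exprS prednK// mulrC.
have -> : p`_n * z ^+ n = - \sum_(i < n) p`_i * z ^+ i.
  apply/eqP; rewrite -addr_eq0; apply/eqP; have := rootP pz.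
  by rewrite horner_coef sp big_ord_recr /= addrC.
rewrite normrN (le_trans (ler_norm_sum _ _ _))// mulr_suml ler_sum// => i _.
rewrite normrM normrX ler_wpM2l// ler_weXn2l ?(ltW z1)//.
by rewrite -ltnS prednK.
Qed.

Lemma cvg_horner (C : numClosedFieldType) (T : Type) (F : set_system T)
    {FF : Filter F} (N : nat) (p : T -> {poly C}) (q : {poly C}) (g : T -> C) (y : C) :
  (forall x, (size (p x) <= N)%N) -> (size q <= N)%N ->
  (forall i, (p x)`_i @[x --> F] --> (q`_i : C)) ->
  g x @[x --> F] --> y -> (p x).[g x] @[x --> F] --> q.[y].
Proof.
move=> sz_p sz_q cvg_p gy; rewrite (horner_coef_wide _ sz_q).
rewrite (_ : (fun x => _) = fun x => \sum_(i < N) (p x)`_i * g x ^+ i); last first.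
  by apply/funext => x; rewrite (horner_coef_wide _ (sz_p x)).
apply: cvg_big => [|i _]; first exact: add_continuous.
apply: cvgM => //.
elim: (i : nat) => [|k IH]; first by under eq_fun do rewrite expr0; exact: cvg_cst.
rewrite exprS; under eq_fun do rewrite exprS.
exact: cvgM.
Qed.

Section RootContinuity.
Variables (C : numClosedFieldType) (T : Type) (F : set_system T).
Context {FF : Filter F}.

(** The order of [C] is partial, so no minimum is taken: the inverse of one plus the sum of the
    inverse norms is below each nonzero norm, and zero entries add nothing since [0^-1 = 0]. *)
Lemma finite_gap (s : seq C) :
  exists2 d : C, 0 < d & forall z, z \in s -> z != 0 -> d <= `|z|.
Proof.
pose S := \sum_(z <- s) `|z|^-1.
have S0 (P : pred C) : 0 <= \sum_(z <- s | P z) `|z|^-1 :> C.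
  by apply: sumr_ge0 => z _; rewrite invr_ge0.
have d0 : 0 < 1 + S by rewrite ltr_pwDl// (S0 xpredT).
exists (1 + S)^-1 => [|z zs z0]; first by rewrite invr_gt0.
rewrite -[leRHS]invrK lef_pV2 ?posrE ?invr_gt0 ?normr_gt0//.
by rewrite /S (big_rem z)//= addrCA lerDl addr_ge0// sumr_ge0// => i _; rewrite invr_ge0.
Qed.

Variables (p : T -> {poly C}) (q : {poly C}).
Hypothesis sz_p : forall x, (size (p x) <= size q)%N.
Hypothesis cvg_p : forall i, (p x)`_i @[x --> F] --> (q`_i : C).

Hypothesis q0 : q != 0.

Lemma near_size : \forall x \near F, size (p x) = size q.
Proof.
have l0 : q`_(size q).-1 != 0 by rewrite -lead_coefE lead_coef_eq0.
have h : \forall x \near F, (p x)`_(size q).-1 != 0.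
  exact: (cvgr_neq0 _ (@cvg_p _)).
near=> x; apply/eqP; rewrite eqn_leq sz_p /=.
rewrite leqNgt; apply/negP => lt.
have /negP : (p x)`_(size q).-1 != 0 by near: x.
apply; rewrite nth_default//.
by rewrite -ltnS prednK// size_poly_gt0.
Unshelve. all: by end_near. Qed.

(** If all roots of [p x] were at distance at least [e] from [y], the factorisation would bound [(p
    x).[y]] below by a fixed positive quantity, whereas it tends to [q.[y] = 0]. *)
Lemma near_root (y e : C) : root q y -> 0 < e ->
  \forall x \near F, exists2 z, root (p x) z & `|z - y| < e.
Proof.
move=> qy e0; set l := lead_coef q.
have l0 : 0 < `|l| by rewrite normr_gt0 lead_coef_eq0.
have h1 : \forall x \near F, `|l| / 2 < `|(p x)`_(size q).-1|.
  apply: (cvgr_norm_gt _ (@cvg_p _)).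
  by rewrite -lead_coefE ltr_pdivrMr// ltr_pMr// ltr1n.
have h2 : \forall x \near F, `|(p x).[y]| < `|l| / 2 * e ^+ (size q).-1.
  apply: (cvgr_norm_lt _ (cvg_horner sz_p (leqnn _) cvg_p (cvg_cst y))).
  rewrite (rootP qy) normr0 mulr_gt0 ?exprn_gt0// divr_gt0//.
have h3 := near_size.
near=> x.
have sx : size (p x) = size q by near: x.
apply: contrapT => nz.
have [r pr] := closed_poly_splits (p x).
have : `|(p x).[y]| < `|l| / 2 * e ^+ (size q).-1 by near: x.
have lx0 : lead_coef (p x) != 0 by rewrite lead_coef_eq0 -size_poly_eq0 sx size_poly_eq0.
have sr : (size q).-1 = size r.
  by rewrite -sx pr size_scale// size_prod_XsubC.
suff ge : `|l| / 2 * e ^+ (size q).-1 <= `|(p x).[y]| by rewrite (le_gtF ge).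
rewrite pr hornerZ normrM horner_prod normr_prod; apply: ler_pM.
- by rewrite divr_ge0.
- by rewrite exprn_ge0// ltW.
- by rewrite lead_coefE sx; apply/ltW; near: x.
have H z : z \in r -> e <= `|y - z|.
  move=> zr; rewrite real_leNgt ?realE ?(ltW e0) ?normr_ge0//.
  apply/negP => lt; apply: nz; exists z; last by rewrite distrC.
  by rewrite pr rootZ// root_prod_XsubC.
have -> : e ^+ (size q).-1 = \prod_(z <- r) e.
  by rewrite sr; elim: (r) => [|a s IH]; rewrite ?big_nil ?big_cons //= exprS IH.
rewrite big_seq [leRHS]big_seq; apply: ler_prod => z zr.
by rewrite (ltW e0) hornerXsubC H.
Unshelve. all: by end_near. Qed.

(** Within half the gap between the roots of [q], roots of [p x] attached to distinct [r_i] are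
    distinct; the degree then shows that these are all the roots. *)
Lemma near_roots (r : seq C) (e : C) :
  q = lead_coef q *: \prod_(z <- r) ('X - z%:P) -> uniq r -> 0 < e ->
  \forall x \near F, exists s : seq C,
    [/\ size s = size r, uniq s,
        p x = lead_coef (p x) *: \prod_(z <- s) ('X - z%:P)
      & forall i, (i < size r)%N -> `|s`_i - r`_i| < e].
Proof.
move=> qr ur e0.
have [d d0 gap] := finite_gap [seq a - b | a <- r, b <- r].
have [c [c0 ce cd]] : exists c : C, [/\ 0 < c, c <= e & c <= d / 2].
  have : (e >=< d / 2)%O by rewrite real_comparable ?gtr0_real ?divr_gt0.
  case/orP => h; first by exists e.
  by exists (d / 2); rewrite divr_gt0.
have szr : size q = (size r).+1.
  by rewrite qr size_scale ?lead_coef_eq0// size_prod_XsubC.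
have : \forall x \near F, forall i : 'I_(size r),
    exists2 z, root (p x) z & `|z - r`_i| < c.
  apply: filter_forall => i; apply: near_root => //.
  by rewrite qr rootZ ?lead_coef_eq0// root_prod_XsubC mem_nth.
apply: filterS2 near_size => x sx /fin_all_exists2[f fr fc].
exists (codom f); rewrite size_codom card_ord.
have fi : injective f.
  move=> i j eqf; apply: contrapT => /eqP nij.
  have nr : r`_i - r`_j != 0 by rewrite subr_eq0 nth_uniq.
  have /(gap _)/(_ nr) : r`_i - r`_j \in [seq a - b | a <- r, b <- r].
    by apply/allpairsP; exists (r`_i, r`_j); rewrite !mem_nth.
  apply/negP; rewrite lt_geF//.
  rewrite (le_lt_trans (ler_distD (f i) _ _))// [ltRHS](splitr d) ltrD//.
    by rewrite distrC (lt_le_trans _ cd).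
  by rewrite eqf (lt_le_trans _ cd).
have us : uniq (codom f) by rewrite map_inj_uniq ?enum_uniq.
split => //.
  apply: all_roots_prod_XsubC; last by rewrite uniq_rootsE.
  - by rewrite size_codom card_ord sx.
  - by apply/allP => z /codomP[i ->].
move=> i ir; rewrite (nth_map (Ordinal ir)) ?size_enum_ord//.
by rewrite (nth_ord_enum _ (Ordinal ir)) (lt_le_trans _ ce)//= fc.
Unshelve. all: by end_near. Qed.

Lemma near_root_unique (w : C) : separable_poly q -> root q w ->
  exists2 e : C, 0 < e & \forall x \near F, forall y z,
    root (p x) y -> root (p x) z -> `|y - w| < e -> `|z - w| < e -> y = z.
Proof.
move=> sq qw; have [r qr] := closed_poly_splits q.
have rP z : root q z = (z \in r).
  by rewrite qr rootZ ?lead_coef_eq0// root_prod_XsubC.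
have ur : uniq r.
  rewrite -separable_prod_XsubC; have := sq.
  by rewrite {1}qr (eqp_separable (eqp_scale _ _))// lead_coef_eq0.
have [d d0 gap] := finite_gap [seq a - b | a <- r, b <- r].
have d20 : 0 < d / 2 by rewrite divr_gt0.
exists (d / 2) => //; apply: filterS2 near_size (near_roots qr ur d20).
move=> x sx [s [ss us ps sr]].
have px0 : p x != 0 by rewrite -size_poly_eq0 sx size_poly_eq0.
have wi : (index w r < size r)%N by rewrite index_mem -rP.
suff H y : root (p x) y -> `|y - w| < d / 2 -> y = s`_(index w r).
  by move=> y z py pz /(H _ py)-> /(H _ pz)->.
rewrite ps rootZ ?lead_coef_eq0// root_prod_XsubC => ys yw.
have yi : (index y s < size r)%N by rewrite -ss index_mem.
suff : r`_(index y s) = w.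
  by move=> <-; rewrite index_uniq// nth_index.
apply: contrapT => /eqP; rewrite -subr_eq0 => n0.
have : d <= `|r`_(index y s) - w|.
  by apply: gap => //; apply/allpairsP; exists (r`_(index y s), w); rewrite mem_nth// -rP.
apply/negP; rewrite lt_geF// (le_lt_trans (ler_distD y _ _))// [ltRHS](splitr d) ltrD//.
by rewrite distrC -{1}(nth_index 0 ys) sr.
Qed.

(** The Cauchy bound keeps the roots [z] of [p x] in a fixed disc of radius [M], where [q - p x] is
    uniformly small; so [q.[z]] is small, and by factorisation [z] is close to a root of [q]. *)
Lemma near_root_rev (e : C) : 0 < e ->
  \forall x \near F, forall z, root (p x) z -> exists2 y, root q y & `|z - y| < e.
Proof.
move=> e0; set n := (size q).-1.
have l0 : 0 < `|lead_coef q| by rewrite normr_gt0 lead_coef_eq0.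
pose B x := \sum_(i < n) `|(p x)`_i| / `|(p x)`_n|.
have [M M1 BM] : exists2 M : C, 1 <= M & \forall x \near F, B x < M.
  have cB : B x @[x --> F] --> \sum_(i < n) `|q`_i| / `|q`_n|.
    apply: cvg_big => [|i _]; first exact: add_continuous.
    apply: cvgM; first exact: cvg_norm.
    by apply: cvgV; rewrite ?normr_eq0 -?lead_coefE ?lead_coef_eq0//; exact: cvg_norm.
  have B0 : 0 <= \sum_(i < n) `|q`_i| / `|q`_n|.
    by apply: sumr_ge0 => i _; rewrite mulr_ge0// invr_ge0.
  exists (1 + \sum_(i < n) `|q`_i| / `|q`_n|); first by rewrite lerDl.
  have lt : `|\sum_(i < n) `|q`_i| / `|q`_n| | < 1 + \sum_(i < n) `|q`_i| / `|q`_n|.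
    by rewrite ger0_norm// ltrDr.
  apply: filterS (cvgr_norm_lt _ cB _ lt) => x; apply: le_lt_trans; rewrite ger0_norm//.
  by apply: sumr_ge0 => i _; rewrite mulr_ge0// invr_ge0.
have small : \forall x \near F,
    \sum_(i < size q) `|q`_i - (p x)`_i| * M ^+ i < `|lead_coef q| * e ^+ n.
  have c0 : (\sum_(i < size q) `|q`_i - (p x)`_i| * M ^+ i) @[x --> F]
      --> \sum_(i < size q) `|q`_i - q`_i| * M ^+ i.
    apply: cvg_big => [|i _]; first exact: add_continuous.
    apply: cvgM; last exact: cvg_cst.
    by apply: cvg_norm; apply: cvgB; [exact: cvg_cst|exact: cvg_p].
  rewrite big1 in c0; last by move=> i _; rewrite subrr normr0 mul0r.
  have lt : `|0 : C| < `|lead_coef q| * e ^+ n.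
    by rewrite normr0 mulr_gt0 ?exprn_gt0.
  apply: filterS (cvgr_norm_lt _ c0 _ lt) => x.
  apply: le_lt_trans; rewrite ger0_norm// sumr_ge0// => i _.
  by rewrite mulr_ge0// exprn_ge0// (le_trans ler01).
have sz := near_size.
near=> x => z pz.
have sx : size (p x) = size q by near: x.
have px0 : p x != 0 by rewrite -size_poly_eq0 sx size_poly_eq0.
have zM : `|z| <= M.
  have [h|] := root_norm_le px0 pz; first exact: le_trans M1.
  by rewrite sx => /le_trans; apply; apply/ltW; near: x.
have [r qr] := closed_poly_splits q.
apply: contrapT => nz.
have ge : `|lead_coef q| * e ^+ n <= `|q.[z]|.
  rewrite [in q.[z]]qr hornerZ normrM horner_prod normr_prod ler_wpM2l//.
  have -> : e ^+ n = \prod_(z <- r) e.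
    have -> : n = size r by rewrite /n qr size_scale ?lead_coef_eq0// size_prod_XsubC.
    by elim: (r) => [|a s IH]; rewrite ?big_nil ?big_cons //= exprS IH.
  rewrite big_seq [leRHS]big_seq; apply: ler_prod => y yr.
  rewrite (ltW e0) hornerXsubC real_leNgt ?realE ?(ltW e0) ?normr_ge0//=.
  apply/negP => lt; apply: nz; exists y => //.
  by rewrite qr rootZ ?lead_coef_eq0// root_prod_XsubC.
have : `|q.[z]| < `|lead_coef q| * e ^+ n.
  apply: (@le_lt_trans _ _ (\sum_(i < size q) `|q`_i - (p x)`_i| * M ^+ i)); last by near: x.
  have -> : q.[z] = q.[z] - (p x).[z] by rewrite (rootP pz) subr0.
  rewrite horner_coef (horner_coef_wide _ (sz_p x)).
  rewrite -sumrB (le_trans (ler_norm_sum _ _ _))// ler_sum// => i _.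
  by rewrite -mulrBl normrM normrX ler_wpM2l// lerXn2r ?nnegrE// (le_trans ler01).
by move=> /lt_geF; rewrite ge.
Unshelve. all: by end_near. Qed.

End RootContinuity.

(** * Fibres of bivariate polynomials *)

Definition fibre (R : comNzRingType) (P : {poly {poly R}}) (t : R) : {poly R} :=
  map_poly (horner_eval t) P.

Section FibreAlgebra.
Variable R : comNzRingType.
Implicit Types P Q : {poly {poly R}}.

Lemma coef_fibre P t i : (fibre P t)`_i = (P`_i).[t].
Proof. by rewrite coef_map. Qed.

Lemma horner_fibre P t w : (fibre P t).[w] = P.[w%:P].[t].
Proof.
by rewrite -/(horner_eval t _) -horner_map /= /horner_eval hornerC.
Qed.

Lemma fibre_swap P t w : (fibre (swapXY P) w).[t] = (fibre P t).[w].
Proof. by rewrite !horner_fibre horner2_swapXY. Qed.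

Lemma size_fibre_le P t : (size (fibre P t) <= size P)%N.
Proof. exact: size_poly. Qed.

Lemma size_fibre P t : (lead_coef P).[t] != 0 -> size (fibre P t) = size P.
Proof. exact: size_map_poly_id0. Qed.

Lemma fibreM P Q t : fibre (P * Q) t = fibre P t * fibre Q t.
Proof. exact: rmorphM. Qed.

Lemma fibreD P Q t : fibre (P + Q) t = fibre P t + fibre Q t.
Proof. exact: rmorphD. Qed.

Lemma fibreZ (a : {poly R}) P t : fibre (a *: P) t = a.[t] *: fibre P t.
Proof. exact: map_polyZ. Qed.

Lemma fibre_deriv P t : fibre P^`() t = (fibre P t)^`().
Proof. by rewrite /fibre deriv_map. Qed.

End FibreAlgebra.

(** In characteristic 0 a root of multiplicity [m] of [p] has multiplicity [m - 1] in the
    derivative, so [D] cannot contain all [m] factors. [D] is any common divisor rather than the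
    gcd, because a gcd need not remain one after specialisation. *)
Lemma root_squarefree_part (C : numFieldType) (p D E G : {poly C}) (w : C) :
  p != 0 -> p = D * E -> p^`() = D * G -> root p w -> root E w.
Proof.
move=> p0 pE pG pw; apply: contraT => Ew.
have [m [q]] := multiplicity_XsubC p w; rewrite p0 /= => qw pq.
have m0 : (0 < m)%N.
  rewrite lt0n; apply/eqP => m0; move: pw qw; rewrite pq m0 expr0 mulr1.
  by move=> ->.
have dD : ('X - w%:P) ^+ m %| D.
  rewrite -(@Gauss_dvdpl _ _ E) -?pE ?pq ?dvdp_mull//.
  by rewrite coprimep_expl// coprimep_sym coprimep_XsubC.
have : ('X - w%:P) ^+ m %| p^`() by rewrite pG dvdp_mulr.
rewrite pq derivM deriv_exp derivXsubC mul1r -(prednK m0) /= dvdp_addr; last first.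
  by rewrite dvdp_mull.
rewrite mulrnAr -mulrnAl exprS dvdp_mul2r; last first.
  by rewrite expf_neq0// polyXsubC_eq0.
by rewrite dvdp_XsubCl rootE hornerMn mulrn_eq0 -rootE (negbTE qw) orbF prednK// eqn0Ngt m0.
Qed.

(** As long as some fibre vanishes identically, a factor ['X - s%:P] divides all coefficients; each
    division shortens the leading coefficient. *)
Lemma strip_content (C : fieldType) (E : {poly {poly C}}) : E != 0 ->
  exists2 g : {poly C}, g != 0 & exists2 E0,
    E = g *: E0 & forall s, fibre E0 s != 0.
Proof.
have [n] := ubnP (size (lead_coef E)); elim: n E => // n IH E sE E0.
have [[s Es]|nE] := pselect (exists s, fibre E s = 0); last first.
  exists 1; rewrite ?oner_eq0//; exists E; first by rewrite scale1r.
  by move=> s; apply/eqP => Es; apply: nE; exists s.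
have Ei i : exists q, E`_i = q * ('X - s%:P).
  by apply/factor_theorem; rewrite rootE -coef_fibre Es coef0.
have [q qE] := choice Ei.
have Eq : E = ('X - s%:P) *: \poly_(i < size E) q i.
  apply/polyP => i; rewrite coefZ coef_poly; case: ltnP => [_|le].
    by rewrite qE mulrC.
  by rewrite mulr0 nth_default.
set Q := \poly_(i < _) _ in Eq.
have Q0 : Q != 0 by apply: contraNneq E0 => Q0; rewrite Eq Q0 scaler0.
have [||g g0 [E1 QE1 nE1]] := IH Q => //.
  move: sE; rewrite {1}Eq lead_coefZ mulrC size_Mmonic ?monicXsubC//; last first.
    by rewrite lead_coef_eq0.
  by rewrite size_XsubC addn2 /=.
exists (('X - s%:P) * g); first by rewrite mulf_neq0// polyXsubC_eq0.
by exists E1 => //; rewrite -scalerA -QE1.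
Qed.

Import Pdiv.Idomain.

(** [E] is the squarefree part of [P] freed of its content. Separability passes to fibres by
    specialising a Bezout relation between [E] and its derivative. *)
Lemma separable_fibres (C : numClosedFieldType) (P : {poly {poly C}}) : P != 0 ->
  exists E : {poly {poly C}}, exists r : {poly C},
  [/\ r != 0, forall s, fibre E s != 0 &
    forall t, r.[t] != 0 -> [/\ size (fibre E t) = size E,
      separable_poly (fibre E t) & forall w, root (fibre P t) w -> root (fibre E t) w]].
Proof.
move=> P0; set D := gcdp P P^`(); pose E := P %/ D.
have [[c2 G] /= c20 PG] := dvdpP _ _ (dvdp_gcdr P P^`()).
have lD : lead_coef D != 0 by rewrite lead_coef_eq0 gcdp_eq0 negb_and P0.
have ED : E * D = lead_coef D ^+ scalp P D *: P by rewrite divpK// dvdp_gcdl.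
set a := lead_coef D ^+ _ in ED.
have a0 : a != 0 by rewrite expf_neq0.
have E0 : E != 0.
  apply: contraNneq P0 => E0; move: ED; rewrite E0 mul0r => /esym/eqP.
  by rewrite scale_poly_eq0 (negbTE a0).
have /Bezout_coprimepP[[u v] /= /eqpP[[b1 b2] /= /andP[b10 b20] uv]] :
  coprimep E E^`() by have := make_separable P0; rewrite unlock.
have [g g0 [E1 EE1 nE1]] := strip_content E0.
(* [r] collects the scalars of pseudo-division and of Bezout ([a], [c2], [b2]), and the leading
   coefficients, whose zeros would lower the degree of a fibre. *)
exists E1; exists (a * c2 * b2 * lead_coef P * lead_coef E); split => //.
  by rewrite !mulf_neq0 ?lead_coef_eq0.
move=> t; rewrite !hornerM !mulf_eq0 !negb_or -!andbA => /and5P[at0 c2t b2t lPt lEt].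
have lE : lead_coef E = g * lead_coef E1 by rewrite EE1 lead_coefZ.
have := lEt; rewrite lE hornerM mulf_eq0 negb_or => /andP[gt lE1t].
have FE : fibre E t = g.[t] *: fibre E1 t by rewrite EE1 fibreZ.
have rootE1 w : root (fibre E1 t) w = root (fibre E t) w by rewrite FE rootZ.
split; first exact: size_fibre.
  suff : separable_poly (fibre E t) by rewrite FE (eqp_separable (eqp_scale _ gt)).
  rewrite unlock; apply/Bezout_coprimepP; exists (b1.[t] *: fibre u t, b1.[t] *: fibre v t) => /=.
  rewrite -fibre_deriv -!scalerAl -!fibreM -scalerDr -fibreD -fibreZ uv fibreZ.
  by rewrite /fibre rmorph1; exact: eqp_scale.
move=> w Pw; rewrite rootE1.
have := @root_squarefree_part _ (fibre P t) (fibre D t) (a.[t]^-1 *: fibre E t)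
  (c2.[t]^-1 *: fibre G t) w.
rewrite rootZ ?invr_eq0//; apply => //.
- by rewrite -size_poly_eq0 size_fibre// size_poly_eq0.
- by rewrite -scalerAr mulrC -fibreM ED fibreZ scalerA mulVf// scale1r.
- by rewrite -scalerAr mulrC -fibreM -PG fibreZ scalerA mulVf// scale1r fibre_deriv.
Qed.

(** * Connectedness of punctured planes *)

Lemma exists_gt_norm (F : numDomainType) (s : seq F) :
  exists2 x : F, 0 <= x & forall z, z \in s -> `|z| < x.
Proof.
have S0 : 0 <= \sum_(z <- s) `|z| by rewrite sumr_ge0.
exists (1 + \sum_(z <- s) `|z|) => [|z zs]; first by rewrite addr_ge0.
by rewrite (big_rem z)//= addrCA ltrDl ltr_pwDl// sumr_ge0.
Qed.

Lemma exists_notin (F : numDomainType) (s : seq F) : exists x, x \notin s.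
Proof.
have [x x0 xs] := exists_gt_norm s; exists x; apply/negP => /xs.
by rewrite ger0_norm// ltxx.
Qed.

(** Connectedness of the complement of the zeros of [h], isolated as a property of [C] so that the
    later arguments apply to any [numClosedFieldType]; it is established for [R[i]], where real
    lines are available. *)
Definition punctures_connected (C : numClosedFieldType) : Prop :=
  forall (h : {poly C}) (A : set C), h != 0 ->
  (forall t, h.[t] != 0 -> A t -> \forall t' \near t, A t') ->
  (forall t, h.[t] != 0 -> ~ A t -> \forall t' \near t, ~ A t') ->
  forall a b, h.[a] != 0 -> h.[b] != 0 -> A a -> A b.

Section PunctureConnected.
Variable R : realType.
Local Notation C := (CC R).

Let line (a v : C) (s : R) : C := a + (s%:C)%C * v.

Lemma line_continuous a v : continuous (line a v).
Proof.
move=> s; apply: cvgD; first exact: cvg_cst.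
apply: cvgM; last exact: cvg_cst.
apply/cvgrPdist_lt => e; case: e => er ei; rewrite ltcE /= => /andP[/eqP -> e0].
near=> t.
rewrite -rmorphB /= normc_def /= expr0n /= addr0 sqrtr_sqr ltcR.
by near: t; apply: cvgr_dist_lt.
Unshelve. all: by end_near. Qed.

Lemma line_clopen (A : set C) (a v : C) :
  (forall s, A (line a v s) -> \forall t \near line a v s, A t) ->
  (forall s, ~ A (line a v s) -> \forall t \near line a v s, ~ A t) ->
  A a -> forall s, A (line a v s).
Proof.
move=> oA oN Aa s.
have : connected [set: R] by apply/connected_intervalP.
move=> /(_ (line a v @^-1` A)) H; suff -> : A (line a v s) = [set: R] s by [].
rewrite -[LHS]/((line a v @^-1` A) s) H//.
- by exists 0; rewrite /= /line mul0r addr0.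
- exists (line a v @^-1` A); rewrite ?setTI// openE => t /= At.
  exact: (line_continuous (oA t At)).
- exists (line a v @^-1` A); rewrite ?setTI// -openC openE => t /= At.
  exact: (line_continuous (oN t At)).
Qed.

(** Two real lines of distinct slopes, one through [a] and one through [b], meet; if both miss the
    zeros of [h], then [A] is clopen along each and membership passes through the meeting point. *)
Lemma punctured_plane_connected : punctures_connected C.
Proof.
move=> h A h0 oA oN a b ha hb Aa.
have [r hr] := closed_poly_splits h.
have rP z : (z \in r) = (h.[z] == 0).
  by rewrite -rootE hr rootZ ?lead_coef_eq0// root_prod_XsubC.
pose v u : C := (1 +i* u)%C.
(* A zero of [h] on the line through [c] would give the slope [u]. A zero vertically above [c] is
   harmless, since directions have real part 1. *)
have slope c (u s : R) : h.[c] != 0 ->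
    u \notin [seq complex.Im (z - c) / complex.Re (z - c) | z <- r] ->
    h.[line c (v u) s] != 0.
  move=> hc; apply: contra => hl; apply/mapP; exists (line c (v u) s).
    by rewrite rP.
  have s0 : s != 0.
    by apply: contraNneq hc => s0; move: hl; rewrite /line s0 mul0r addr0.
  rewrite /line addrAC subrr add0r /= mulr1 !mul0r subr0 addr0.
  by field.
have [u ua] := exists_notin [seq complex.Im (z - a) / complex.Re (z - a) | z <- r].
have [w] := exists_notin (u :: [seq complex.Im (z - b) / complex.Re (z - b) | z <- r]).
rewrite inE negb_or => /andP[wu wb].
pose x := complex.Re (b - a); pose y := complex.Im (b - a).
pose s' := (y - u * x) / (u - w).
(* Both directions have real part 1, so at the common point the two parameters differ by the real
   part [x] of [b - a]. *)
have meet : line a (v u) (s' + x) = line b (v w) s'.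
  apply/eqP; rewrite /line -subr_eq0 opprD addrACA -opprB -/x.
  rewrite (_ : b - a = (x +i* y)%C); last by rewrite /x /y; case: (b - a).
  rewrite /v; simpc; rewrite eq_complex /= /s'.
  apply/andP; split; apply/eqP; first by ring.
  by field; rewrite subr_eq0 eq_sym.
apply: contrapT => nAb.
have : ~ A (line b (v w) s').
  apply: (@line_clopen (~` A)) => // s; first by apply: oN; exact: slope.
  by move=> /contrapT /oA; move=> /(_ (slope _ _ _ hb wb)); apply: filterS => t ? ; apply.
rewrite -meet; apply; apply: line_clopen => // s; first by apply: oA; exact: slope.
by apply: oN; exact: slope.
Qed.

End PunctureConnected.

(** * Algebraic functions of one variable *)

Section OneVariable.
Variable C : numClosedFieldType.
Implicit Types (P E : {poly {poly C}}) (h g q : {poly C}) (f : C -> C).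

Lemma cvg_near (T : Type) (F : set_system T) {FF : Filter F} (f : T -> C) (l e : C) :
  f x @[x --> F] --> l -> 0 < e -> \forall x \near F, `|f x - l| < e.
Proof.
by move=> /cvgrPdist_lt H e0; apply: filterS (H e e0) => x; rewrite distrC.
Qed.

Lemma horner_cvg q (t : C) : q.[x] @[x --> t] --> q.[t].
Proof.
apply: (@cvg_horner C C (nbhs t) _ (size q) (fun=> q) q id) => // i.
exact: cvg_cst.
Qed.

Lemma near_horner_neq0 q (t : C) : q.[t] != 0 -> \forall x \near t, q.[x] != 0.
Proof. by move=> qt; apply: (cvgr_neq0 _ (@horner_cvg q t)). Qed.

Lemma coef_fibre_cvg P (t : C) i : (fibre P x)`_i @[x --> t] --> (fibre P t)`_i.
Proof.
rewrite coef_fibre; under eq_fun do rewrite coef_fibre.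
exact: horner_cvg.
Qed.

Section FullDegree.
Variables (E : {poly {poly C}}) (t0 : C).
Hypothesis sE : size (fibre E t0) = size E.

Lemma fibre_size_le x : (size (fibre E x) <= size (fibre E t0))%N.
Proof. by rewrite sE size_fibre_le. Qed.

Definition fibre_near_root :=
  @near_root _ _ (nbhs t0) _ _ _ fibre_size_le (@coef_fibre_cvg E t0).
Definition fibre_near_root_rev :=
  @near_root_rev _ _ (nbhs t0) _ _ _ fibre_size_le (@coef_fibre_cvg E t0).
Definition fibre_near_root_unique :=
  @near_root_unique _ _ (nbhs t0) _ _ _ fibre_size_le (@coef_fibre_cvg E t0).
End FullDegree.

Lemma common_radius (s : seq C) (Q : C -> C -> Prop) :
  (forall z d d', d <= d' -> Q z d' -> Q z d) ->
  (forall z, z \in s -> exists2 d, 0 < d & Q z d) ->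
  exists2 d, 0 < d & forall z, z \in s -> Q z d.
Proof.
move=> Qmono; elim: s => [|a s IH] Qs; first by exists 1.
have [|d d0 Qd] := IH; first by move=> z zs; apply: Qs; rewrite inE zs orbT.
have [d1 d10 Q1] := Qs _ (mem_head _ _).
have : (d >=< d1)%O by rewrite real_comparable ?gtr0_real.
case/orP => le; [exists d => //|exists d1 => //] => z; rewrite inE => /predU1P[->|zs].
- exact: Qmono Q1.
- exact: Qd.
- exact: Q1.
- exact: Qmono (Qd _ zs).
Qed.

Hypothesis conn : punctures_connected C.

Lemma bounded_algebraic_constant h P f (M : C) :
    h != 0 -> P != 0 ->
    (forall t, h.[t] != 0 -> f x @[x --> t] --> f t) ->
    (forall t, h.[t] != 0 -> root (fibre P t) (f t)) ->
    (forall t, h.[t] != 0 -> `|f t| <= M) ->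
  exists2 h' : {poly C}, h' != 0 & exists c, forall t, h'.[t] != 0 -> f t = c.
Proof.
move=> h0 P0 fc fP fM.
have [E [r [r0 nE EP]]] := separable_fibres P0.
pose k := h * r; have k0 : k != 0 by rewrite mulf_neq0.
have kP t : k.[t] != 0 -> h.[t] != 0 /\ r.[t] != 0.
  by rewrite hornerM mulf_eq0 negb_or => /andP[].
have kE t : k.[t] != 0 -> root (fibre E t) (f t).
  by move=> /kP[/fP ? /EP[_ _]]; apply.
have [s ks] := closed_poly_splits k.
have sP z : (z \in s) = (k.[z] == 0).
  by rewrite -rootE ks rootZ ?lead_coef_eq0// root_prod_XsubC.
pose W := swapXY E.
have E0 : E != 0 by apply: contraNneq (nE 0) => ->; rewrite /fibre rmorph0.
have W0 : W != 0 by rewrite swapXY_eq0.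
(* Two kinds of values are discarded: those where the fibre of [W] drops degree, and those that are
   roots of [E] over a puncture of [k]. Preimages of the remaining values stay away from the
   punctures. The product is nonzero because no fibre of [E] vanishes. *)
pose b := lead_coef W * \prod_(z <- s) fibre E z.
have b0 : b != 0.
  rewrite mulf_neq0 ?lead_coef_eq0// prodf_seq_neq0.
  by apply/allP => z _; rewrite nE.
have bP w : b.[w] != 0 -> size (fibre W w) = size W /\
    forall t, root (fibre W w) t -> k.[t] != 0.
  rewrite hornerM mulf_eq0 negb_or => /andP[lw pw]; split; first exact: size_fibre.
  move=> t; rewrite rootE fibre_swap => Ew; rewrite -sP; apply: contra pw => ts.
  by rewrite horner_prod (big_rem t)//= (eqP Ew) mul0r.
pose A := [set w | exists2 t, k.[t] != 0 & f t = w].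
have kA t : k.[t] != 0 -> root (fibre W (f t)) t.
  by move=> kt; rewrite rootE fibre_swap; exact: kE.
(* A value [w'] close to [w] is a root of the fibre of [E] at some [z] close to [t0]. So is [f z],
   and a simple root has only one root near it; hence [f z = w']. *)
have oA w : b.[w] != 0 -> A w -> \forall w' \near w, A w'.
  move=> bw [t0 kt0 ftw]; have [sW _] := bP w bw.
  have [ht0 rt0] := kP _ kt0; have [sE sepE EPt] := EP _ rt0.
  have w0r : root (fibre E t0) w by rewrite -ftw; exact: kE.
  have [e e0 uniqE] := fibre_near_root_unique sE (nE t0) sepE w0r.
  have : \forall t \near t0, [/\ k.[t] != 0, `|f t - w| < e &
      forall y z, root (fibre E t) y -> root (fibre E t) z ->
        `|y - w| < e -> `|z - w| < e -> y = z].
    have := uniqE; apply: filterS3 (near_horner_neq0 kt0) _.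
      by move=> t kt ft ut; split; [exact: kt|exact: ft|exact: ut].
    by rewrite -ftw; exact: cvg_near (fc _ ht0) e0.
  move=> /nbhs_ballP[d /= d0 Bd].
  have W0w : fibre W w != 0 by rewrite -size_poly_eq0 sW size_poly_eq0.
  have t0r : root (fibre W w) t0 by rewrite -ftw; exact: kA.
  have := fibre_near_root sW W0w t0r d0.
  apply: filterS2 (nbhsx_ballx w e e0) => w' w'e [z Wz zt0].
  have [kz fze uz] : [/\ k.[z] != 0, `|f z - w| < e &
      forall y z', root (fibre E z) y -> root (fibre E z) z' ->
        `|y - w| < e -> `|z' - w| < e -> y = z'].
    by apply: Bd; rewrite -ball_normE /= distrC.
  exists z => //; apply: uz => //; first exact: kE.
    by rewrite rootE -fibre_swap.
  by move: w'e; rewrite -ball_normE /= distrC.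
(* If [f t = w'] with [w'] close to [w], then [t] is close to one of the finitely many [z] at which
   [w] is a root; there [f z] differs from [w], and continuity keeps [f t] away from [w]. *)
have oN w : b.[w] != 0 -> ~ A w -> \forall w' \near w, ~ A w'.
  move=> bw nAw; have [sW rW] := bP w bw.
  have W0w : fibre W w != 0 by rewrite -size_poly_eq0 sW size_poly_eq0.
  have [l lW] := closed_poly_splits (fibre W w).
  have lP z : (z \in l) = root (fibre W w) z.
    by rewrite lW rootZ ?lead_coef_eq0// root_prod_XsubC.
  have [d d0 dP] : exists2 d, 0 < d &
      forall z, z \in l -> forall t, `|t - z| < d -> d <= `|f t - w|.
    apply: common_radius => [z d d' dd' H t td|z].
      by apply: (le_trans dd'); apply: H; exact: lt_le_trans td dd'.
    rewrite lP => zW; have kz := rW _ zW; have [hz _] := kP _ kz.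
    have fz : f z - w != 0.
      by rewrite subr_eq0; apply/negP => /eqP fz; apply: nAw; exists z.
    have : \forall t \near z, `|f z - w| / 2 < `|f t - w|.
      have c1 : f x - w @[x --> z] --> f z - w.
        by apply: (cvgB (fc _ hz)); exact: cvg_cst.
      apply: (cvgr_norm_gt _ c1).
      by rewrite ltr_pdivrMr// ltr_pMr ?normr_gt0// ltr1n.
    move=> /nbhs_ballP[d /= d0 Bd].
    have e0 : 0 < `|f z - w| / 2 by rewrite divr_gt0 ?normr_gt0.
    have : (d >=< `|f z - w| / 2)%O by rewrite real_comparable ?gtr0_real.
    case/orP => le; [exists d => //|exists (`|f z - w| / 2) => //] => t tz.
      by rewrite (le_trans le)// ltW//; apply: Bd; rewrite -ball_normE /= distrC.
    by rewrite ltW//; apply: Bd; rewrite -ball_normE /= distrC (lt_le_trans tz).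
  have := fibre_near_root_rev sW W0w d0.
  apply: filterS2 (nbhsx_ballx w d d0) => w' w'd Wz [t kt ftw'].
  have [|y] := Wz t; first by rewrite -ftw'; exact: kA.
  rewrite -lP => yl ty; have := dP _ yl _ ty; rewrite ftw'.
  by apply/negP; rewrite lt_geF//; move: w'd; rewrite -ball_normE /= distrC.
(* Otherwise the image contains every value outside the zeros of [b], in particular some of norm
   larger than [M]. *)
have bf t : k.[t] != 0 -> b.[f t] = 0.
  move=> kt; apply/eqP; apply: contraT => bft.
  have [l bl] := closed_poly_splits b.
  have [x x0 xl] := exists_gt_norm (M :: l).
  have bx : b.[x] != 0.
    apply/negP => bx; have : x \in M :: l.
      rewrite inE; apply/orP; right; move: bx.
      by rewrite -rootE bl rootZ ?lead_coef_eq0// root_prod_XsubC.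
    by move=> /xl; rewrite ger0_norm// ltxx.
  have Aft : A (f t) by exists t.
  have [t1 kt1 ft1] := conn b0 oA oN bft bx Aft.
  have [ht1 _] := kP _ kt1.
  have := fM _ ht1; rewrite ft1 ger0_norm// => xM.
  have := xl _ (mem_head _ _); rewrite ger0_norm ?(le_trans x0 xM)//.
  by rewrite (le_gtF xM).
have [t0 kt0] : exists t0, k.[t0] != 0.
  by have [z zs] := exists_notin s; exists z; rewrite -sP.
exists k => //; exists (f t0) => t kt.
have [l bl] := closed_poly_splits b.
(* All values of [f] are thus roots of [b]. Having finitely many values, [f] is locally constant,
   and connectedness is applied a second time, now to the domain. *)
have lP z : k.[z] != 0 -> f z \in l.
  by move=> /bf /eqP; rewrite -rootE bl rootZ ?lead_coef_eq0// root_prod_XsubC.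
have [d d0 gap] := finite_gap [seq z - f t0 | z <- l].
apply: (@conn k [set t | f t = f t0] k0 _ _ t0 t) => //.
- move=> {kt}t kt /= ft; have [ht _] := kP _ kt.
  apply: filterS2 (near_horner_neq0 kt) (cvg_near (fc _ ht) d0) => z kz zt.
  apply: contrapT => /eqP; rewrite -subr_eq0 => nz.
  have /gap/(_ nz) : f z - f t0 \in [seq z - f t0 | z <- l].
    by apply: map_f; exact: lP.
  by apply/negP; rewrite lt_geF// -ft.
- move=> {kt}t kt /= ft; have [ht _] := kP _ kt.
  have nz : f t - f t0 != 0 by rewrite subr_eq0; exact/eqP.
  have c1 : f x - f t0 @[x --> t] --> f t - f t0.
    by apply: (cvgB (fc _ ht)); exact: cvg_cst.
  apply: filterS (cvgr_neq0 _ c1 nz) => z; rewrite subr_eq0.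
  by move=> /eqP.
Qed.

Lemma norm_horner_le q D (t : C) : (size q <= D.+1)%N ->
  `|q.[t]| <= (\sum_(i < D.+1) `|q`_i|) * (1 + `|t|) ^+ D.
Proof.
move=> sq; rewrite (horner_coef_wide _ sq) (le_trans (ler_norm_sum _ _ _))//.
rewrite mulr_suml ler_sum// => i _; rewrite normrM normrX ler_wpM2l//.
apply: (@le_trans _ _ ((1 + `|t|) ^+ i)); first by rewrite lerXn2r ?nnegrE ?addr_ge0// lerDr.
by rewrite ler_weXn2l ?lerDl// -ltnS.
Qed.

(* Dividing out a good point t0 lowers the growth exponent: the difference
   quotient stays bounded near t0 because f t0 is a simple root of the fibre. *)
Lemma algebraic_growth_polynomial D h P f (M : C) :
    h != 0 -> P != 0 ->
    (forall t, h.[t] != 0 -> f x @[x --> t] --> f t) ->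
    (forall t, h.[t] != 0 -> root (fibre P t) (f t)) ->
    (forall t, h.[t] != 0 -> `|f t| <= M * (1 + `|t|) ^+ D) ->
  exists2 h' : {poly C}, h' != 0 &
    exists2 g : {poly C}, (size g <= D.+1)%N & forall t, h'.[t] != 0 -> f t = g.[t].
Proof.
elim: D h P f M => [|D IH] h P f M h0 P0 fc fP fM.
  have [|h' h'0 [c fE]] := bounded_algebraic_constant (M := M) h0 P0 fc fP.
    by move=> t /fM; rewrite expr0 mulr1.
  by exists h' => //; exists c%:P => [|t /fE->]; rewrite ?size_polyC_leq1// hornerC.
have [E [r [r0 nE EP]]] := separable_fibres P0.
have [s hrs] := closed_poly_splits (h * r).
have hr0 : h * r != 0 by rewrite mulf_neq0.
have [t0] := exists_notin s.
have -> : (t0 \in s) = root (h * r) t0.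
  by rewrite hrs rootZ ?lead_coef_eq0// root_prod_XsubC.
rewrite rootM negb_or => /andP[ht0 rt0].
have [sE sepE EPt] := EP _ rt0.
set w := f t0; have Ew : root (fibre E t0) w by exact/EPt/fP.
(* At [T = f t] this gives [(f t - w) * d(f t) = - E(w)], and [E(w)] is divisible by [t - t0]; hence
   [k t = - g / d(f t)]. At [t0] the denominator is the derivative of the fibre at the simple root
   [w]. *)
have [d dE] : exists d, E - (E.[w%:P])%:P = d * ('X - w%:P%:P).
  by apply/factor_theorem; rewrite rootE !hornerE subrr.
have Ed t : fibre E t = fibre d t * ('X - w%:P) + (E.[w, t])%:P.
  rewrite -[E in LHS](subrK (E.[w%:P])%:P) dE fibreD fibreM; congr (_ * _ + _).
    by rewrite /fibre rmorphB /= map_polyX map_polyC /= /horner_eval hornerC.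
  by rewrite /fibre map_polyC.
have dw : (fibre d t0).[w] != 0.
  have := sepE; rewrite Ed -horner_fibre (rootP Ew) addr0 separable_root.
  by case/andP.
have [g gE] : exists g, E.[w%:P] = g * ('X - t0%:P).
  by apply/factor_theorem; rewrite rootE -horner_fibre.
pose k t := (f t - w) / (t - t0).
have [K [K0 near_k]] : exists K, 0 <= K /\ \forall t \near t0, `|k t| <= K.
  exists ((`|g.[t0]| + 1) / (`|(fibre d t0).[w]| / 2)); split.
    by rewrite divr_ge0 ?addr_ge0 ?divr_ge0.
  have c1 : (fibre d x).[f x] @[x --> t0] --> (fibre d t0).[w].
    apply: (@cvg_horner C C (nbhs t0) _ (size d)).
    - by move=> x; exact: size_fibre_le.
    - exact: size_fibre_le.
    - by move=> i; exact: coef_fibre_cvg.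
    - exact: fc.
  have lo : `|(fibre d t0).[w]| / 2 < `|(fibre d t0).[w]|.
    by rewrite ltr_pdivrMr// ltr_pMr ?normr_gt0// ltr1n.
  have hi : `|g.[t0]| < `|g.[t0]| + 1 by rewrite ltrDl.
  have near_lo : \forall t \near t0, `|(fibre d t0).[w]| / 2 < `|(fibre d t).[f t]|.
    exact: (cvgr_norm_gt _ c1 _ lo).
  have near_hi : \forall t \near t0, `|g.[t]| < `|g.[t0]| + 1.
    exact: (cvgr_norm_lt _ (@horner_cvg g t0) _ hi).
  have near_h := near_horner_neq0 ht0; have near_r := near_horner_neq0 rt0.
  near=> t.
  have ht : h.[t] != 0 by near: t.
  have rt : r.[t] != 0 by near: t.
  have [tt0|tt0] := eqVneq t t0.
    by rewrite /k tt0 (subrr t0) invr0 mulr0 normr0 divr_ge0 ?addr_ge0 ?divr_ge0.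
  have dlo : `|(fibre d t0).[w]| / 2 < `|(fibre d t).[f t]| by near: t.
  have [_ _ EPt'] := EP _ rt; have := rootP (EPt' _ (fP _ ht)).
  rewrite Ed gE !hornerE /= => /eqP; rewrite addr_eq0 => /eqP dg.
  have tt1 : t - t0 != 0 by rewrite subr_eq0.
  have dt0 : (fibre d t).[f t] != 0.
    by rewrite -normr_gt0 (le_lt_trans _ dlo)// divr_ge0.
  have -> : k t = - g.[t] / (fibre d t).[f t].
    by rewrite /k; apply/eqP; rewrite eqr_div// [X in X == _]mulrC dg mulNr.
  rewrite normrM normrN normfV ler_pM ?invr_ge0//; first by apply/ltW; near: t.
  by rewrite lef_pV2 ?posrE ?normr_gt0// ?ltW// divr_gt0// normr_gt0.
(* The difference quotient is again algebraic: substitute [w + (t - t0) * T] for the outer variable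
   of [P]. *)
have Pk : exists2 Pk : {poly {poly C}}, Pk != 0 &
    forall t y, root (fibre P t) (w + (t - t0) * y) -> root (fibre Pk t) y.
  pose A : {poly {poly C}} := w%:P%:P + ('X - t0%:P) *: 'X.
  exists (P \Po A).
    have sA : size A = 2.
      rewrite /A addrC size_addl size_scale ?polyXsubC_eq0// size_polyX//.
      by rewrite (leq_ltn_trans (size_polyC_leq1 _)).
    by rewrite -size_poly_eq0 size_comp_poly2// size_poly_eq0.
  move=> t y; rewrite !rootE /fibre map_comp_poly horner_comp.
  rewrite /A rmorphD /= map_polyZ map_polyC map_polyX /= /horner_eval.
  by rewrite !hornerE.
have [Q Q0 QP] := Pk.
move: near_k => /nbhs_ballP[e /= e0 Be].
have M0 : 0 <= M.
  have := le_trans (normr_ge0 _) (fM _ ht0).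
  by rewrite pmulr_lge0// exprn_gt0// ltr_pwDl.
(* Chosen so that [1 + |t| <= c * |t - t0|] as soon as [e <= |t - t0|]; this trades one power of
   [1 + |t|] for the denominator of [k]. *)
pose c := (1 + `|t0|) / e + 1.
have c0 : 0 <= c by rewrite addr_ge0// divr_ge0 ?addr_ge0// ltW.
have [|||||h' h'0 [q sq kq]] := IH (h * ('X - t0%:P)) Q k (K + (M + `|w|) * c).
- by rewrite mulf_neq0// polyXsubC_eq0.
- exact: Q0.
- move=> t; rewrite hornerM mulf_eq0 negb_or hornerXsubC => /andP[ht tt0].
  have c1 : f x - w @[x --> t] --> f t - w.
    by apply: (cvgB (fc _ ht)); exact: cvg_cst.
  have c2 : x - t0 @[x --> t] --> t - t0.
    by apply: (@cvgB _ _ _ (nbhs t) _ id) => //; exact: cvg_cst.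
  exact: (cvgM c1 (cvgV tt0 c2)).
- move=> t; rewrite hornerM mulf_eq0 negb_or hornerXsubC => /andP[ht tt0].
  by apply: QP; rewrite /k mulrC divfK// addrC subrK; exact: fP.
- move=> t; rewrite hornerM mulf_eq0 negb_or hornerXsubC => /andP[ht tt0].
  have p1 : 1 <= 1 + `|t| by rewrite lerDl.
  have pD n : 1 <= (1 + `|t|) ^+ n by rewrite exprn_ege1.
  have pD0 n : 0 <= (1 + `|t|) ^+ n by rewrite (le_trans ler01).
  rewrite mulrDl; have [te|te] : `|t - t0| < e \/ e <= `|t - t0|.
    by have [] := real_leP (gtr0_real e0) (normr_real (t - t0)); [right|left].
  - apply: (@le_trans _ _ (K * (1 + `|t|) ^+ D)).
      rewrite (@le_trans _ _ K)//; first by apply: Be; rewrite -ball_normE /= distrC.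
      by rewrite ler_peMr.
    by rewrite lerDl mulr_ge0// mulr_ge0// addr_ge0.
  apply: (@le_trans _ _ ((M + `|w|) * c * (1 + `|t|) ^+ D)); last first.
    by rewrite lerDr mulr_ge0.
  have n0 : 0 < `|t - t0| by rewrite normr_gt0.
  rewrite normrM normfV ler_pdivrMr//.
  apply: (@le_trans _ _ ((M + `|w|) * (1 + `|t|) ^+ D.+1)).
    rewrite (le_trans (ler_normB _ _))// mulrDl lerD//; first exact: fM.
    by rewrite ler_peMr.
  rewrite -!mulrA ler_wpM2l ?addr_ge0// exprSr mulrCA ler_wpM2l//.
  rewrite /c mulrDl mul1r.
  apply: (@le_trans _ _ (1 + `|t0| + `|t - t0|)).
    by rewrite -addrA lerD2l -{1}[t](subrK t0) addrC (le_trans (ler_normD _ _)).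
  by rewrite lerD2r mulrAC ler_pdivlMr// ler_wpM2l// addr_ge0.
exists (h' * h * ('X - t0%:P)); first by rewrite !mulf_neq0// polyXsubC_eq0.
exists (w%:P + ('X - t0%:P) * q).
  rewrite (leq_trans (size_polyD _ _))// geq_max (leq_trans (size_polyC_leq1 _))//.
  have [->|q0] := eqVneq q 0; first by rewrite mulr0 size_poly0.
  by rewrite size_proper_mul ?size_XsubC ?lead_coefXsubC ?mul1r ?lead_coef_eq0.
move=> t; rewrite !hornerM !mulf_eq0 !negb_or hornerXsubC -andbA => /and3P[h't ht tt0].
by rewrite !hornerE -kq// /k mulrC divfK// addrC subrK.
Unshelve. all: by end_near. Qed.

(** The Cauchy bound turns the monic equation into growth of order [D], even near the zeros of [h].
    The bound on the degree depends only on [P], so it is uniform over a family of lines. *)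
Lemma algebraic_entire_polynomial D h P f : h != 0 -> P \is monic ->
    (forall i, (size (P`_i)%R <= D.+1)%N) ->
    (forall t, h.[t] != 0 -> f x @[x --> t] --> f t) ->
    (forall t, h.[t] != 0 -> root (fibre P t) (f t)) ->
  exists2 g : {poly C}, (size g <= D.+1)%N & forall t, h.[t] != 0 -> f t = g.[t].
Proof.
move=> h0 monP sP fc fP.
have monf t : fibre P t \is monic by exact: monic_map.
pose K := 1 + \sum_(i < (size P).-1) \sum_(j < D.+1) `|(P`_i)`_j|.
have K0 : 0 <= \sum_(i < (size P).-1) \sum_(j < D.+1) `|(P`_i)`_j|.
  by apply: sumr_ge0 => i _; exact: sumr_ge0.
have [|h' h'0 [g sg fg]] :=
    algebraic_growth_polynomial (D := D) (M := K) h0 (monic_neq0 monP) fc fP.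
  move=> t ht; have p1 : 1 <= (1 + `|t|) ^+ D by rewrite exprn_ege1// lerDl.
  have [f1|] := root_norm_le (monic_neq0 (monf t)) (fP t ht).
    by rewrite (le_trans f1)// mulr_ege1// lerDl.
  have sPt : size (fibre P t) = size P.
    by rewrite size_fibre// (monicP monP) hornerC oner_eq0.
  have -> : (fibre P t)`_(size (fibre P t)).-1 = 1.
    by rewrite -lead_coefE (monicP (monf t)).
  move=> /le_trans; apply; rewrite sPt /K normr1 mulrDl mul1r.
  rewrite (@le_trans _ _ ((K - 1) * (1 + `|t|) ^+ D))//; last first.
    by rewrite /K addrAC subrr add0r lerDr (le_trans ler01).
  rewrite /K addrAC subrr add0r mulr_suml ler_sum// => i _.
  by rewrite divr1 coef_fibre norm_horner_le.
exists g => // t ht; apply/eqP; rewrite -subr_eq0; apply: contraT => nfg.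
have c1 : f x - g.[x] @[x --> t] --> f t - g.[t].
  exact: (cvgB (fc _ ht) (@horner_cvg g t)).
have := cvgr_neq0 _ c1 nfg.
have [s hs] := closed_poly_splits h'.
have [d d0 gap] := finite_gap [seq z - t | z <- s].
move=> /(_ _)/nbhs_ballP[e /= e0 Be].
(* The point [t + c] is closer to [t] than any other zero of [h'], so [f] and [g] agree there, yet
   it lies in the ball where they differ. *)
have [c c0 [cd ce]] : exists2 c : C, 0 < c & c < d /\ c < e.
  have : (d >=< e)%O by rewrite real_comparable ?gtr0_real.
  case/orP => le; [exists (d / 2)|exists (e / 2)]; rewrite ?divr_gt0//.
    have d2 : d / 2 < d by rewrite ltr_pdivrMr// ltr_pMr// ltr1n.
    by split => //; exact: lt_le_trans le.
  have d2 : e / 2 < e by rewrite ltr_pdivrMr// ltr_pMr// ltr1n.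
  by split => //; exact: lt_le_trans le.
have h't : h'.[t + c] != 0.
  apply/negP; rewrite -rootE hs rootZ ?lead_coef_eq0// root_prod_XsubC => tcs.
  have : t + c - t \in [seq z - t | z <- s] by exact: map_f.
  move=> /gap; rewrite addrAC subrr add0r gt_eqF// => /(_ isT).
  by rewrite gtr0_norm// lt_geF.
have : f (t + c) - g.[t + c] != 0.
  by apply: Be; rewrite -ball_normE /= opprD addNKr normrN gtr0_norm.
by rewrite fg// subrr eqxx.
Qed.

End OneVariable.

(** * Generically rational functions *)

Section GenericRationality.
Variables (C : numClosedFieldType) (A : idomainType) (T : topologicalType).
Variable e : T -> {rmorphism A -> C}.
Implicit Types (Z : set T) (a b h p q : A) (f g : T -> C).

(** Points [T] and functions [A] are abstract, tied only by the evaluations [e x]; one statement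
    then covers both polynomials in n variables and [{poly A}] on [T * C]. *)
Definition vanish Z a := forall x, Z x -> e x a = 0.

Definition alg_closed Z := forall x, (forall a, vanish Z a -> e x a = 0) -> Z x.

(** Primality of the vanishing ideal. *)
Definition alg_irreducible Z :=
  ~ vanish Z 1 /\ forall a b, vanish Z (a * b) -> vanish Z a \/ vanish Z b.

Definition generically_rational Z f := exists p, exists2 q, ~ vanish Z q &
  forall x, Z x -> e x q != 0 -> f x = e x p / e x q.

(* P is monic, so that f is integral and fibrewise of polynomial growth. *)
Definition continuous_algebraic_rational : Prop :=
  forall Z f h (P : {poly A}), alg_closed Z -> alg_irreducible Z ->
    ~ vanish Z h -> P \is monic ->
    (forall x, Z x -> e x h != 0 -> f @ within Z (nbhs x) --> f x) ->
    (forall x, Z x -> e x h != 0 -> root (map_poly (e x) P) (f x)) ->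
  generically_rational Z f.

Lemma nvanishP Z a : ~ vanish Z a -> exists2 x, Z x & e x a != 0.
Proof.
move=> nv; apply: contrapT => H; apply: nv => x Zx; apply/eqP.
by apply: contraT => nz; case: H; exists x.
Qed.

Lemma vanishMl Z a b : vanish Z b -> vanish Z (a * b).
Proof. by move=> va x Zx; rewrite rmorphM va// mulr0. Qed.

Lemma vanishD Z a b : vanish Z a -> vanish Z b -> vanish Z (a + b).
Proof. by move=> va vb x Zx; rewrite rmorphD va// vb// addr0. Qed.

Lemma vanishB Z a b : vanish Z a -> vanish Z b -> vanish Z (a - b).
Proof. by move=> va vb x Zx; rewrite rmorphB va// vb// subr0. Qed.

Section Closure.
Variable Z : set T.
Hypothesis irrZ : alg_irreducible Z.

Lemma nvanishM a b : ~ vanish Z a -> ~ vanish Z b -> ~ vanish Z (a * b).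
Proof. by move=> na nb /(irrZ.2 _ _)[]. Qed.

Lemma nvanishX a n : ~ vanish Z a -> ~ vanish Z (a ^+ n).
Proof.
move=> na; elim: n => [|n IH]; first by rewrite expr0; exact: irrZ.1.
by rewrite exprS; exact: nvanishM.
Qed.

Lemma nvanish_prod (I : Type) (r : seq I) (F : I -> A) :
  (forall i, ~ vanish Z (F i)) -> ~ vanish Z (\prod_(i <- r) F i).
Proof.
move=> nF; elim: r => [|i r IH]; first by rewrite big_nil; exact: irrZ.1.
by rewrite big_cons; exact: nvanishM.
Qed.

Lemma rational_eval a : generically_rational Z (fun x => e x a).
Proof.
exists a, 1; first exact: irrZ.1.
by move=> x _ _; rewrite rmorph1 divr1.
Qed.

Lemma rationalD f g : generically_rational Z f -> generically_rational Z g ->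
  generically_rational Z (fun x => f x + g x).
Proof.
move=> [p [q nq fq]] [p' [q' nq' gq]]; exists (p * q' + p' * q), (q * q').
  exact: nvanishM.
move=> x Zx; rewrite rmorphD !rmorphM mulf_eq0 negb_or => /andP[q0 q'0].
by rewrite fq// gq// addf_div.
Qed.

Lemma rationalM f g : generically_rational Z f -> generically_rational Z g ->
  generically_rational Z (fun x => f x * g x).
Proof.
move=> [p [q nq fq]] [p' [q' nq' gq]]; exists (p * p'), (q * q').
  exact: nvanishM.
move=> x Zx; rewrite !rmorphM mulf_eq0 negb_or => /andP[q0 q'0].
by rewrite fq// gq// mulf_div.
Qed.

Lemma rational_inv a : ~ vanish Z a -> generically_rational Z (fun x => (e x a)^-1).
Proof. by move=> na; exists 1, a => // x _ _; rewrite rmorph1 div1r. Qed.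

Lemma rational_ext f g h : ~ vanish Z h ->
  (forall x, Z x -> e x h != 0 -> f x = g x) ->
  generically_rational Z g -> generically_rational Z f.
Proof.
move=> nh fg [p [q nq gq]]; exists (p * h), (q * h); first exact: nvanishM.
move=> x Zx; rewrite !rmorphM mulf_eq0 negb_or => /andP[q0 h0].
by rewrite fg// gq// -mulf_div divff// mulr1.
Qed.

Lemma rational_sum n (F : 'I_n -> T -> C) :
  (forall i, generically_rational Z (F i)) ->
  generically_rational Z (fun x => \sum_i F i x).
Proof.
elim: n F => [|n IH] F rF.
  apply: (rational_ext irrZ.1) (rational_eval 0) => x _ _.
  by rewrite big_ord0 rmorph0.
have := rationalD (rF ord0) (IH (fun i => F (lift ord0 i)) (fun i => rF _)).
by apply: (rational_ext irrZ.1) => x _ _; rewrite big_ord_recl.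
Qed.

End Closure.

Lemma one_point_rational (k : C -> A) : (forall x c, e x (k c) = c) ->
  (forall x y : T, x = y) -> continuous_algebraic_rational.
Proof.
move=> kP T1 Z f h P _ irrZ _ _ _ _.
have [x Zx _] := nvanishP irrZ.1.
apply: (rational_ext irrZ irrZ.1) (rational_eval irrZ (k (f x))) => y _ _.
by rewrite kP (T1 x y).
Qed.

End GenericRationality.

Lemma pair_continuousr (S T : topologicalType) (x : S) (y : T) :
  (fun y' => (x, y')) @ y --> (x, y).
Proof.
move=> V [[V1 V2] [/= n1 n2] sub]; apply: filterS n2 => y' V2y'.
by apply: sub; split => //=; exact: nbhs_singleton.
Qed.

Lemma pair_continuousl (S T : topologicalType) (x : S) (y : T) :
  (fun x' => (x', y)) @ x --> (x, y).
Proof.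
move=> V [[V1 V2] [/= n1 n2] sub]; apply: filterS n1 => x' V1x'.
by apply: sub; split => //=; exact: nbhs_singleton.
Qed.

(** * Integrality in rings of functions *)

Section PulledBackRing.
Variables (C : numClosedFieldType) (A : idomainType) (T : Type).
Variables (e : T -> {rmorphism A -> C}) (I : pointedType) (r : I -> T).

(** Maps [A] into the ring of all functions [I -> C], so that closure of integral elements under
    sums and products applies to arbitrary functions, including discontinuous choices of a root. *)
Definition pull (a : A) : I -> C := fun i => e (r i) a.

Lemma pull_is_zmod : zmod_morphism pull.
Proof. by move=> a b; apply/funext => i; rewrite /pull rmorphB. Qed.

HB.instance Definition _ := GRing.isZmodMorphism.Build A (I -> C) pull pull_is_zmod.

Lemma pull_is_monoid : monoid_morphism pull.
Proof.
split; first by apply/funext => i; rewrite /pull rmorph1.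
by move=> a b; apply/funext => i; rewrite /pull rmorphM.
Qed.

HB.instance Definition _ := GRing.isMonoidMorphism.Build A (I -> C) pull pull_is_monoid.

Definition at_index (i : I) (g : I -> C) : C := g i.

Lemma at_index_is_zmod i : zmod_morphism (at_index i).
Proof. by []. Qed.

HB.instance Definition _ i :=
  GRing.isZmodMorphism.Build (I -> C) C (at_index i) (at_index_is_zmod i).

Lemma at_index_is_monoid i : monoid_morphism (at_index i).
Proof. by []. Qed.

HB.instance Definition _ i :=
  GRing.isMonoidMorphism.Build (I -> C) C (at_index i) (at_index_is_monoid i).

Lemma pullE a i : pull a i = e (r i) a. Proof. by []. Qed.

Lemma fun_mulE (g g' : I -> C) i : (g * g') i = g i * g' i. Proof. by []. Qed.

Lemma fun_addE (g g' : I -> C) i : (g + g') i = g i + g' i. Proof. by []. Qed.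

Lemma fun_expE (g : I -> C) n i : (g ^+ n) i = g i ^+ n.
Proof. exact: (rmorphXn (at_index i)). Qed.

Lemma fun_sumE (J : Type) (s : seq J) (F : J -> I -> C) i :
  (\sum_(j <- s) F j) i = \sum_(j <- s) F j i.
Proof. exact: (rmorph_sum (at_index i)). Qed.

Lemma horner_at (p : {poly (I -> C)}) g i : p.[g] i = (map_poly (at_index i) p).[g i].
Proof. by rewrite -/(at_index i g) horner_map. Qed.

Lemma root_pull (M : {poly A}) (g : I -> C) :
  root (map_poly pull M) g <-> forall i, root (map_poly (e (r i)) M) (g i).
Proof.
have E i : (map_poly pull M).[g] i = (map_poly (e (r i)) M).[g i].
  by rewrite horner_at -map_poly_comp.
split=> [/rootP H i|H]; first by rewrite rootE -E H.
by rewrite rootE; apply/eqP/funext => i; rewrite E; exact/rootP/H.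
Qed.

Lemma integral_pullP (g : I -> C) : integralOver pull g <->
  exists2 M, M \is monic & forall i, root (map_poly (e (r i)) M) (g i).
Proof.
by split=> -[M mM /root_pull H]; exists M.
Qed.

Lemma integralOver_sum (J : Type) (s : seq J) (F : J -> I -> C) :
  (forall j, integralOver pull (F j)) -> integralOver pull (\sum_(j <- s) F j).
Proof.
move=> iF; elim: s => [|j s IH]; first by rewrite big_nil; exact: mxpoly.integral0.
by rewrite big_cons; exact: integral_add.
Qed.

Lemma integralOver_exp (g : I -> C) n : integralOver pull g -> integralOver pull (g ^+ n).
Proof.
move=> ig; elim: n => [|n IH]; first by rewrite expr0; exact: mxpoly.integral1.
by rewrite exprS; exact: integral_mul.
Qed.

Section ScaledIntegral.
Variables (Q : {poly A}) (y : I -> C).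
Hypothesis sQ : (1 < size Q)%N.
Hypothesis Qy : forall i, root (map_poly (e (r i)) Q) (y i).
Let a := lead_coef Q.

Lemma integral_lead_root : integralOver pull (pull a * y).
Proof.
set n := (size Q).-2; have sQn : size Q = n.+2 by rewrite /n; case: (size Q) sQ => [|[|]].
(* [Q] has degree [n.+1]; multiplying [Q(y) = 0] by [a ^+ n] gives a monic equation in [a * y]. *)
pose q := \poly_(i < n.+1) (a ^+ (n - i) * Q`_i).
apply/integral_pullP; exists ('X^(n.+1) + q).
  rewrite monicE lead_coefDl ?lead_coefXn// size_polyXn ltnS; exact: size_poly.
move=> i; rewrite rmorphD /= map_polyXn rootE hornerD hornerXn.
have -> : (map_poly (e (r i)) q).[(pull a * y) i] =
    e (r i) a ^+ n * \sum_(j < n.+1) e (r i) Q`_j * y i ^+ j.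
  have sq : (size (map_poly (e (r i)) q) <= n.+1)%N.
    by rewrite (leq_trans (size_poly _ _))// size_poly.
  rewrite (horner_coef_wide _ sq) mulr_sumr; apply: eq_bigr => j _.
  rewrite coef_map coef_poly ltn_ord /= rmorphM rmorphXn /=.
  rewrite fun_mulE pullE exprMn.
  have -> : e (r i) a ^+ n = e (r i) a ^+ (n - j) * e (r i) a ^+ j.
    by rewrite -exprD subnK// -ltnS.
  by ring.
have := rootP (Qy i); rewrite (@horner_coef_wide _ n.+2); last first.
  by rewrite (leq_trans (size_poly _ _))// sQn.
rewrite big_ord_recr /= coef_map /= -[Q`_n.+1]/(Q`_(n.+2).-1) -sQn -lead_coefE -/a.
under eq_bigr do rewrite coef_map /=.
move=> /eqP; rewrite addr_eq0 => /eqP ->.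
rewrite fun_mulE pullE exprMn.
by apply/eqP; rewrite exprSr; ring.
Qed.

(** Each power of [y] absorbs one factor [a], leaving polynomials in the integral element
    [a * y]. *)
Lemma integral_scaled_horner (p : {poly A}) N : (size p <= N)%N ->
  integralOver pull (pull a ^+ N * (fun i => (map_poly (e (r i)) p).[y i])).
Proof.
move=> sp.
have -> : pull a ^+ N * (fun i => (map_poly (e (r i)) p).[y i]) =
    \sum_(j < N) pull p`_j * pull a ^+ (N - j) * (pull a * y) ^+ j.
  apply/funext => i.
  rewrite fun_mulE fun_expE pullE fun_sumE.
  rewrite (@horner_coef_wide _ N); last by rewrite (leq_trans (size_poly _ _)).
  rewrite mulr_sumr; apply: eq_bigr => j _.
  rewrite !fun_mulE !fun_expE fun_mulE !pullE coef_map exprMn.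
  have -> : e (r i) a ^+ N = e (r i) a ^+ (N - j) * e (r i) a ^+ j.
    by rewrite -exprD subnK// ltnW.
  by ring.
apply: integralOver_sum => j; apply: integral_mul; last first.
  by apply: integralOver_exp; exact: integral_lead_root.
by apply: integral_mul; [exact: integral_id|apply: integralOver_exp; exact: integral_id].
Qed.

Lemma integral_scaled_root (P : {poly {poly A}}) (g : I -> C)
    (phi : I -> {rmorphism {poly A} -> C}) :
  (forall i p, phi i p = (map_poly (e (r i)) p).[y i]) ->
  P \is monic -> (forall i, root (map_poly (phi i) P) (g i)) ->
  exists N, integralOver pull (pull a ^+ N * g).
Proof.
move=> phiE monP Pg; set m := (size P).-1.
have sP : size P = m.+1 by rewrite /m prednK// size_poly_gt0 monic_neq0.
(* Multiplying the equation by [a ^+ (N * m)] makes it monic in [a ^+ N * g]. Its coefficient of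
   index [k < m] gains [a ^+ (N * (m - k))], at least [N] factors, which suffices to make it
   integral; transitivity of integrality concludes. *)
pose N := \max_(k < m) size (P`_k)%R; exists N.
pose c (k : nat) : I -> C := fun i => (map_poly (e (r i)) P`_k).[y i].
pose q : {poly (I -> C)} := \poly_(k < m) (pull a ^+ (N * (m - k)) * c k).
have sq : (size q <= m)%N by exact: size_poly.
apply: (@integral_root_monic _ _ _ _ ('X^m + q)).
- by rewrite monicE lead_coefDl ?lead_coefXn// size_polyXn ltnS.
- rewrite rootE hornerD hornerXn (horner_coef_wide _ sq); apply/eqP/funext => i.
  rewrite fun_addE fun_sumE fun_expE fun_mulE fun_expE pullE.
  have := rootP (Pg i); rewrite (@horner_coef_wide _ m.+1); last first.
    by rewrite (leq_trans (size_poly _ _))// sP.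
  have lP : P`_m = 1 by rewrite -(monicP monP) lead_coefE.
  have e1 : (map_poly (phi i) P)`_m = 1.
    by rewrite coef_map; rewrite lP; apply: rmorph1.
  rewrite big_ord_recr /= e1 mul1r addrC => /eqP; rewrite addr_eq0 => /eqP gm.
  rewrite exprMn -exprM gm mulrN addrC mulr_sumr -[0 i]/(0 : C).
  apply/eqP; rewrite subr_eq0; apply/eqP/eq_bigr => k _.
  have -> : (map_poly (phi i) P)`_k = c k i by rewrite coef_map; exact: phiE.
  have -> : q`_k = pull a ^+ (N * (m - k)) * c k by rewrite coef_poly ltn_ord.
  rewrite !fun_mulE !fun_expE fun_mulE fun_expE pullE exprMn -exprM.
  have -> : e (r i) a ^+ (N * m) = e (r i) a ^+ (N * (m - k)) * e (r i) a ^+ (N * k).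
    by rewrite -exprD -mulnDr subnK// ltnW.
  by ring.
- apply/integral_poly => k; rewrite coefD coefXn coef_poly.
  apply: integral_add; first exact: integral_nat.
  case: ifP => km; last exact: mxpoly.integral0.
  apply: integral_scaled_horner.
  rewrite (@leq_trans N)//; last by rewrite leq_pmulr// subn_gt0.
  by rewrite /N (bigD1 (Ordinal km))//= leq_maxl.
Qed.
End ScaledIntegral.

End PulledBackRing.

(* Rings of functions are nontrivial, as integralOver requires, only over a
   pointed type. *)
Definition pointed_at (T : Type) (x : T) : Type := T.
HB.instance Definition _ (T : choiceType) (x : T) := Choice.copy (pointed_at x) T.
HB.instance Definition _ (T : choiceType) (x : T) := isPointed.Build (pointed_at x) x.

(** * Adding one variable *)

(** [d] is [(Q(T) - Q(Y)) / (T - Y)], with [T] the outer variable and [Y] the inner one, the latter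
    being specialised by [phi]. *)
Lemma divided_difference (A : comNzRingType) (Q : {poly A}) :
  exists d : {poly {poly A}}, forall (K : comNzRingType) (phi : {rmorphism {poly A} -> K}),
    map_poly (phi \o polyC) Q - (phi Q)%:P = map_poly phi d * ('X - (phi 'X)%:P).
Proof.
have [d dE] : exists d, map_poly polyC Q - Q%:P = d * ('X - 'X%:P).
  apply/factor_theorem; rewrite rootE hornerD hornerN hornerC.
  by rewrite -[_.['X]]/(Q \Po 'X) comp_polyXr subrr.
exists d => K phi; have := congr1 (map_poly phi) dE.
by rewrite rmorphM !rmorphB /= !map_polyC map_polyX /= -map_poly_comp.
Qed.

Lemma exists_minimal_size (R : nzRingType) (Pr : {poly R} -> Prop) :
  (exists p, Pr p) -> exists2 p, Pr p & forall q, Pr q -> (size p <= size q)%N.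
Proof.
move=> [p]; have [n] := ubnP (size p); elim: n p => // n IH p pn Prp.
have [[q Prq qp]|H] := pselect (exists2 q, Pr q & (size q < size p)%N).
  by apply: (IH q) => //; rewrite (leq_trans qp).
by exists p => // q Prq; rewrite leqNgt; apply/negP => qp; apply: H; exists q.
Qed.

Section AddVariable.
Variables (C : numClosedFieldType) (A : idomainType) (T : topologicalType).
Variable e : T -> {rmorphism A -> C}.
Hypothesis conn : punctures_connected C.
Hypothesis e_cont : forall a, continuous (fun x => e x a).
Variable k : C -> A.
Hypothesis kP : forall x c, e x (k c) = c.
Hypothesis ratA : continuous_algebraic_rational e.

Definition eval_poly (x : T * C) : {rmorphism {poly A} -> C} :=
  (horner_eval x.2 \o map_poly (e x.1)).
Local Notation pvanish := (@vanish C {poly A} (T * C)%type eval_poly).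
Local Notation prational := (@generically_rational C {poly A} (T * C)%type eval_poly).

Lemma eval_polyE (x : T) y p : eval_poly (x, y) p = (map_poly (e x) p).[y].
Proof. by []. Qed.

Lemma eval_polyC (z : T * C) a : eval_poly z a%:P = e z.1 a.
Proof. by case: z => x y; rewrite eval_polyE map_polyC hornerC. Qed.

Section Step.
Variables (Z : set (T * C)) (f : T * C -> C) (h : {poly A}) (P : {poly {poly A}}).
Hypothesis clZ : @alg_closed C {poly A} (T * C)%type eval_poly Z.
Hypothesis irrZ : @alg_irreducible C {poly A} (T * C)%type eval_poly Z.
Hypothesis nh : ~ pvanish Z h.
Hypothesis monP : P \is monic.
Hypothesis fc : forall z, Z z -> eval_poly z h != 0 -> f @ within Z (nbhs z) --> f z.
Hypothesis fP : forall z, Z z -> eval_poly z h != 0 -> root (map_poly (eval_poly z) P) (f z).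

(** The Zariski closure of the projection of [Z], which itself need not be closed. *)
Definition base : set T := [set x | forall a, pvanish Z a%:P -> e x a = 0].

Lemma vanish_base a : vanish e base a <-> pvanish Z a%:P.
Proof.
split=> [va z Zz|va x]; last exact.
rewrite eval_polyC; apply: va => b vb.
by rewrite -eval_polyC vb.
Qed.

Lemma base_closed : alg_closed e base.
Proof. by move=> x vx a va; apply/vx/vanish_base. Qed.

Lemma base_irreducible : alg_irreducible e base.
Proof.
split=> [|a b]; first by rewrite vanish_base; exact: irrZ.1.
by rewrite !vanish_base polyCM; exact: irrZ.2.
Qed.

Lemma base_rational g : generically_rational e base g ->
  prational Z (fun z => g z.1).
Proof.
move=> [p [q nq gq]]; exists p%:P, q%:P; first by rewrite -vanish_base.
move=> z Zz; rewrite !eval_polyC => q0; apply: gq => // a va.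
by rewrite -eval_polyC va.
Qed.

Lemma rational_y g : generically_rational e base g -> forall i,
  prational Z (fun z => g z.1 * z.2 ^+ i).
Proof.
move=> rg i; apply: (rationalM irrZ (base_rational rg)).
apply: (rational_ext irrZ irrZ.1) (rational_eval irrZ 'X^i) => -[x y] _ _.
by rewrite eval_polyE map_polyXn hornerXn.
Qed.

Lemma rational_horner (q : {poly C}) : prational Z (fun z => q.[z.2]).
Proof.
have := rational_eval irrZ (\poly_(i < size q) k q`_i).
apply: (rational_ext irrZ irrZ.1) => -[x y] _ _.
rewrite eval_polyE poly_def rmorph_sum horner_sum horner_coef.
by apply: eq_bigr => i _; rewrite /= map_polyZ map_polyXn hornerZ hornerXn kP.
Qed.

Lemma cylinder_step :
  (forall p, pvanish Z p -> forall i, pvanish Z (p`_i)%:P) -> prational Z f.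
Proof.
move=> cyl.
have Zxy x y : base x -> Z (x, y).
  move=> bx; apply: clZ => p vp; rewrite eval_polyE horner_coef big1// => i _.
  by rewrite coef_map /= (bx _ (cyl _ vp _)) mul0r.
(* [D] bounds the degrees in [y] of the coefficients of [P], hence, for every [x] at once, the
   degree of [f] on the line over [x]. *)
pose hx x := map_poly (e x) h; pose D := \max_(i < size P) size (P`_i)%R.
have sP i : (size (P`_i)%R <= D.+1)%N.
  have [iP|iP] := ltnP i (size P); last by rewrite nth_default// size_poly0.
  by rewrite leqW// /D (bigD1 (Ordinal iP))//= leq_maxl.
have fibreE x y : fibre (map_poly (map_poly (e x)) P) y = map_poly (eval_poly (x, y)) P.
  by rewrite /fibre -map_poly_comp.
have poly_y x : base x -> hx x != 0 -> exists2 g : {poly C},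
    (size g <= D.+1)%N & forall y, (hx x).[y] != 0 -> f (x, y) = g.[y].
  move=> bx hx0; apply: (algebraic_entire_polynomial conn hx0
    (P := map_poly (map_poly (e x)) P)).
  - exact: monic_map.
  - by move=> i; rewrite coef_map /= (leq_trans (size_poly _ _)).
  - move=> y hy U /(fc (Zxy x y bx) hy) nU.
    suff : \forall y' \near y, U (f (x, y')) by [].
    have nV : \forall z \near (x, y), Z z -> U (f z) by exact: nU.
    have nW : \forall y' \near y, Z (x, y') -> U (f (x, y')).
      exact: (pair_continuousr nV).
    by apply: filterS nW => y'; apply; exact: Zxy.
  - by move=> y hy; rewrite fibreE; apply: fP => //; exact: Zxy.
have [[x0 y0] Z0 h0] := nvanishP nh.
have bx0 : base x0 by move=> a va; rewrite -(eval_polyC (x0, y0)) va.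
have hx0 : hx x0 != 0.
  by apply: contraNneq h0 => hx0; rewrite eval_polyE -/(hx x0) hx0 horner0.
have [s hs] := closed_poly_splits (hx x0).
have [b b0 bs] := exists_gt_norm s.
(* Interpolation nodes beyond all zeros of [h] on the line over the single point [x0]. This makes
   each [a j] nonzero at [x0], so the nodes are good over generic [x]. *)
pose c (j : nat) : C := b + j%:R.
have c_inj : injective c by move=> i j /addrI /eqP; rewrite eqr_nat => /eqP.
have hc j : (hx x0).[c j] != 0.
  apply/negP; rewrite -rootE hs rootZ ?lead_coef_eq0// root_prod_XsubC => /bs.
  by rewrite ger0_norm ?addr_ge0// gtrDl ltrn0.
pose a j := h.[k (c j)].
have aE x j : e x (a j) = (hx x).[c j] by rewrite -horner_map kP.
have na j : ~ vanish e base (a j) by move=> /(_ x0 bx0)/eqP; rewrite aE (negbTE (hc j)).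
have rF j : generically_rational e base (fun x => f (x, c j)).
  apply: (ratA base_closed base_irreducible (na j) (P := map_poly (horner_eval (k (c j))) P)).
  - exact: monic_map.
  - move=> x bx; rewrite aE => hxj U /(fc (Zxy x (c j) bx) hxj) nU.
    suff : \forall x' \near x, base x' -> U (f (x', c j)) by [].
    have nV : \forall z \near (x, c j), Z z -> U (f z) by exact: nU.
    have nW : \forall x' \near x, Z (x', c j) -> U (f (x', c j)).
      exact: (pair_continuousl nV).
    by apply: filterS nW => x' + bx'; apply; exact: Zxy.
  - move=> x bx; rewrite aE => hxj.
    rewrite -map_poly_comp (eq_map_poly (g := eval_poly (x, c j))).
      by apply: fP => //; exact: Zxy.
    by move=> p; rewrite eval_polyE /= /horner_eval -horner_map kP.
pose L (j : 'I_D.+1) : {poly C} := tnth (lagrange D.+1 c) j.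
have rG : prational Z (fun z => \sum_(j < D.+1) f (z.1, c j) * (L j).[z.2]).
  apply: rational_sum => // j; apply: rationalM => //.
    exact: (base_rational (rF j)).
  exact: rational_horner.
apply: (@rational_ext _ _ _ _ _ irrZ _ _ (h * (\prod_(j < D.+1) a j)%:P) _ _ rG).
  apply: nvanishM => //; rewrite -vanish_base.
  by apply: nvanish_prod => //; exact: base_irreducible.
move=> [x y] Zz; rewrite rmorphM mulf_eq0 negb_or eval_polyC => /andP[hxy pxy].
have bx : base x by move=> d vd; rewrite -(eval_polyC (x, y)) vd.
have hx1 : hx x != 0.
  by apply: contraNneq hxy => hx1; rewrite eval_polyE -/(hx x) hx1 horner0.
have [g sg fg] := poly_y x bx hx1.
rewrite fg// (lagrange_gen (ltn0Sn D) c_inj sg) horner_sum.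
apply: eq_bigr => j _; rewrite hornerM hornerC fg// -aE.
by apply: contra pxy => /eqP aj; rewrite rmorph_prod (bigD1 j)//= aj mul0r.
Qed.

(** Stands for being zero as a polynomial over the coordinate ring of [base]. *)
Definition base_zero (p : {poly A}) := forall x, base x -> map_poly (e x) p = 0.

Lemma base_fst z : Z z -> base z.1.
Proof. by move=> Zz a va; rewrite -eval_polyC va. Qed.

Lemma base_zeroP p : base_zero p <-> forall i, pvanish Z (p`_i)%:P.
Proof.
split=> [zp i|vp x bx]; last by apply/polyP => i; rewrite coef_map coef0 /= bx.
by apply/vanish_base => x bx; rewrite -coef_map zp// coef0.
Qed.

Lemma base_zero_vanish p : base_zero p -> pvanish Z p.
Proof. by move=> zp [x y] /base_fst bx; rewrite eval_polyE zp// horner0. Qed.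

Lemma base_zero0 : base_zero 0.
Proof. by move=> x bx; rewrite rmorph0. Qed.

Lemma base_zeroD p q : base_zero p -> base_zero q -> base_zero (p + q).
Proof. by move=> zp zq x bx; rewrite rmorphD /= zp// zq// addr0. Qed.

Lemma base_zeroMl p q : base_zero q -> base_zero (p * q).
Proof. by move=> zq x bx; rewrite rmorphM /= zq// mulr0. Qed.

Lemma base_zero_congr p q : base_zero (p - q) -> pvanish Z p <-> pvanish Z q.
Proof.
move=> /base_zero_vanish pq; split=> [vp|vq].
  by rewrite -(subKr p q); exact: vanishB.
by rewrite -(subrK q p); exact: vanishD.
Qed.

(** Otherwise deleting the leading term gives a shorter congruent polynomial, which still satisfies
    [Pr]. *)
Lemma lead_minimal (Pr : {poly A} -> Prop) p :
  (forall p q, base_zero (p - q) -> Pr p -> Pr q) ->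
  Pr p -> (forall q, Pr q -> (size p <= size q)%N) -> ~ base_zero p ->
  ~ pvanish Z (lead_coef p)%:P.
Proof.
move=> congr Prp minp nz vl.
have p0 : p != 0 by apply/eqP => p0; apply: nz; rewrite p0; exact: base_zero0.
have sp : (0 < size p)%N by rewrite size_poly_gt0.
pose q := \poly_(i < (size p).-1) p`_i.
have : Pr q.
  apply: congr Prp; apply/base_zeroP => i; rewrite coefB coef_poly.
  case: ltnP => [_|le]; first by rewrite subrr => z _; rewrite rmorph0.
  rewrite subr0; have [<-//|ne] := eqVneq (size p).-1 i.
  rewrite nth_default; first by move=> z _; rewrite rmorph0.
  by rewrite -(prednK sp) ltn_neqAle ne.
move=> /minp; rewrite leqNgt; apply/negP/negPn.
by rewrite (leq_ltn_trans (size_poly _ _))// prednK.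
Qed.

Lemma nvanish_lead_scale (a : A) n p : ~ pvanish Z a%:P ->
  pvanish Z (a ^+ n *: p) -> pvanish Z p.
Proof.
move=> na; rewrite -mul_polyC => /(irrZ.2 _ _)[|//].
by rewrite rmorphXn => va; case: (nvanishX irrZ na va).
Qed.

(** * The minimal polynomial of the last coordinate over the base *)

Section MinimalRelation.
Hypothesis ncyl : ~ forall p, pvanish Z p -> forall i, pvanish Z (p`_i)%:P.

Lemma minimal_relation : exists Q, [/\ pvanish Z Q, ~ pvanish Z (lead_coef Q)%:P,
  (1 < size Q)%N & forall p, pvanish Z p -> (size p < size Q)%N -> base_zero p].
Proof.
pose Pr p := pvanish Z p /\ ~ base_zero p.
have [Q [vQ nzQ] minQ] : exists2 Q, Pr Q & forall p, Pr p -> (size Q <= size p)%N.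
  apply: exists_minimal_size; apply: contrapT => H; apply: ncyl => p vp.
  by apply/base_zeroP; apply: contrapT => nz; apply: H; exists p.
have nl : ~ pvanish Z (lead_coef Q)%:P.
  apply: (@lead_minimal Pr) => // p q pq [vp nz]; split.
    by apply/(base_zero_congr pq).
  by move=> zq; apply: nz; rewrite -(subrK q p); exact: base_zeroD.
exists Q; split=> // [|p vp]; last first.
  rewrite ltnNge => /negP H; apply: contrapT => nz; apply: H.
  exact: minQ.
rewrite ltnNge; apply/negP => /size1_polyC Qc; apply: nl.
by rewrite Qc lead_coefC -Qc.
Qed.

Variable Q : {poly A}.
Hypothesis vQ : pvanish Z Q.
Hypothesis nlQ : ~ pvanish Z (lead_coef Q)%:P.
Hypothesis sQ : (1 < size Q)%N.
Hypothesis minQ : forall p, pvanish Z p -> (size p < size Q)%N -> base_zero p.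

Lemma relation_neq0 : Q != 0.
Proof. by rewrite -size_poly_gt0 ltnW. Qed.

(** The pseudo-remainder vanishes on [Z] and is shorter than [Q], so minimality kills it over the
    base. *)
Lemma relation_dvd p : pvanish Z p ->
  base_zero (lead_coef Q ^+ scalp p Q *: p - p %/ Q * Q).
Proof.
move=> vp; rewrite divp_eq addrAC subrr add0r; apply: minQ.
  have -> : p %% Q = lead_coef Q ^+ scalp p Q *: p - p %/ Q * Q.
    by rewrite divp_eq addrAC subrr add0r.
  by apply: vanishB; [rewrite -mul_polyC|]; exact: vanishMl.
by rewrite ltn_modp relation_neq0.
Qed.

(* Euclid's algorithm over the fraction field of A modulo the ideal of the base,
   with denominators cleared. *)
Lemma relation_bezout g : ~ pvanish Z g ->
  exists2 r, ~ pvanish Z r%:P & exists u v, base_zero (u * Q + v * g - r%:P).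
Proof.
move=> ng.
pose Pr w := ~ base_zero w /\ exists u v, base_zero (u * Q + v * g - w).
have PrE w w' : base_zero (w - w') -> Pr w -> Pr w'.
  move=> ww' [nz [u [v H]]]; split.
    by move=> zw'; apply: nz; rewrite -(subrK w' w); exact: base_zeroD.
  exists u, v; rewrite -(subrK w (u * Q + v * g)) -addrA.
  exact: base_zeroD.
have [w Prw minw] : exists2 w, Pr w & forall w', Pr w' -> (size w <= size w')%N.
  apply: exists_minimal_size; exists g; split.
    by move=> /base_zero_vanish.
  by exists 0, 1; rewrite mul0r add0r mul1r subrr; exact: base_zero0.
have [nzw [u [v uvw]]] := Prw.
have nlw := lead_minimal PrE Prw minw nzw.
have w0 : w != 0 by apply/eqP => w0; apply: nzw; rewrite w0; exact: base_zero0.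
(* A remainder modulo [w] is again a combination of [Q] and [g], shorter than [w], hence zero over
   the base by minimality of [w]. *)
have red a b : base_zero (lead_coef w ^+ scalp (a * Q + b * g) w *: (a * Q + b * g)
    - (a * Q + b * g) %/ w * w).
  set G := a * Q + b * g; set l := lead_coef w ^+ _.
  rewrite divp_eq addrAC subrr add0r; apply: contrapT => nz.
  have : Pr (G %% w).
    split=> //; exists (l%:P * a - G %/ w * u), (l%:P * b - G %/ w * v).
    have -> : (l%:P * a - G %/ w * u) * Q + (l%:P * b - G %/ w * v) * g - G %% w
       = - (G %/ w) * (u * Q + v * g - w).
      have := divp_eq G w; rewrite -/l -mul_polyC => GE.
      have -> : G %% w = l%:P * G - G %/ w * w by rewrite GE addrAC subrr add0r.
      by rewrite /G; ring.
    exact: base_zeroMl.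
  by move=> /minw; rewrite leqNgt ltn_modp w0.
have vw : pvanish Z w -> False.
  move=> vw; have := red 0 1; rewrite mul0r add0r mul1r => /base_zero_vanish H.
  apply: ng; apply: (nvanish_lead_scale nlw (n := scalp g w)).
  by rewrite -(subrK (g %/ w * w) (_ *: g)); apply: vanishD => //; exact: vanishMl.
have [sw|sw] := leqP (size w) 1.
  have wc := size1_polyC sw; exists w`_0; first by rewrite -wc.
  by exists u, v; rewrite -wc.
(* A nonconstant [w] would be a factor of [Q] up to scaling. By primality [w] or the cofactor
   vanishes on [Z]: the former forces [g] to vanish, the latter is shorter than [Q], so it and then
   [Q] would be zero over the base. *)
have := red 1 0; rewrite mul1r mul0r addr0 => Qw.
have : pvanish Z (Q %/ w * w).
  rewrite -(subKr (lead_coef w ^+ scalp Q w *: Q) (Q %/ w * w)).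
  apply: vanishB; last exact: base_zero_vanish.
  by rewrite -mul_polyC; exact: vanishMl.
move=> /(irrZ.2 _ _)[vs|/vw//].
have zs : base_zero (Q %/ w).
  apply: minQ => //; rewrite size_divp// ltn_subrL -ltnS prednK ?size_poly_gt0//.
  by rewrite sw relation_neq0.
exfalso.
have : base_zero (lead_coef w ^+ scalp Q w *: Q).
  rewrite -(subrK (Q %/ w * w) (_ *: Q)); apply: base_zeroD => //.
  by rewrite mulrC; exact: base_zeroMl.
move=> /base_zeroP/(_ (size Q).-1); rewrite coefZ -lead_coefE polyCM rmorphXn.
by move=> /(irrZ.2 _ _)[]//; exact: nvanishX.
Qed.

(** * Traces along the finite projection to the base *)

Section Trace.
(* Over the points where dl does not vanish, the fibre of Z is the set of roots
   of Q, which are simple and avoid the zeros of h. *)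
Variable dl : A.
Let good x := base x /\ e x dl != 0.
Let q x := map_poly (e x) Q.
Hypothesis ndl : ~ pvanish Z dl%:P.
Hypothesis good_lead : forall x, good x -> e x (lead_coef Q) != 0.
Hypothesis good_sep : forall x, good x -> separable_poly (q x).
Hypothesis good_roots : forall x, good x -> forall y, root (q x) y ->
  Z (x, y) /\ eval_poly (x, y) h != 0.

Definition fibre_roots x : seq C := sval (closed_field_poly_normal (q x)).

(** The trace of [f * w]. Being symmetric in the roots, it is insensitive to their order, which in
    general cannot be chosen continuously. *)
Definition fibre_trace (w : {poly A}) x : C :=
  \sum_(y <- fibre_roots x) f (x, y) * eval_poly (x, y) w.

Lemma good_size x : good x -> size (q x) = size Q.
Proof. by move=> gx; rewrite size_map_poly_id0// good_lead. Qed.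

Lemma good_neq0 x : good x -> q x != 0.
Proof. by move=> gx; rewrite -size_poly_gt0 good_size// ltnW. Qed.

Lemma fibre_rootsE x : q x = lead_coef (q x) *: \prod_(z <- fibre_roots x) ('X - z%:P).
Proof. by rewrite /fibre_roots; case: closed_field_poly_normal. Qed.

Lemma mem_fibre_roots x : good x -> forall y, (y \in fibre_roots x) = root (q x) y.
Proof.
move=> gx y; rewrite [in RHS]fibre_rootsE rootZ ?lead_coef_eq0 ?good_neq0//.
by rewrite root_prod_XsubC.
Qed.

Lemma fibre_roots_uniq x : good x -> uniq (fibre_roots x).
Proof.
move=> gx; rewrite -separable_prod_XsubC; have := good_sep gx.
by rewrite fibre_rootsE (eqp_separable (eqp_scale _ _))// lead_coef_eq0 good_neq0.
Qed.

Lemma size_fibre_roots x : good x -> size (fibre_roots x) = (size Q).-1.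
Proof.
move=> gx; rewrite -(good_size gx) [in RHS]fibre_rootsE.
by rewrite size_scale ?lead_coef_eq0 ?good_neq0// size_prod_XsubC.
Qed.

Lemma eval_poly_continuous p : continuous (fun z => eval_poly z p).
Proof.
move=> [x y].
apply: (@cvg_horner C (T * C)%type (nbhs (x, y)) _ (size p)
  (fun z => map_poly (e z.1) p) (map_poly (e x) p) snd y).
- by move=> z; exact: size_poly.
- exact: size_poly.
- move=> i; rewrite coef_map; under eq_fun do rewrite coef_map.
  by apply: (@cvg_comp _ _ _ fst (fun x => e x p`_i)); [exact: cvg_fst|exact: e_cont].
- exact: cvg_snd.
Qed.

Lemma trace_continuous w x0 : good x0 ->
  fibre_trace w @ within base (nbhs x0) --> fibre_trace w x0.
Proof.
move=> gx0; have [bx0 dx0] := gx0.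
pose F := within base (nbhs x0).
pose phi z := f z * eval_poly z w.
have szq x : (size (q x) <= size (q x0))%N by rewrite (good_size gx0) size_poly.
have cq i : (q x)`_i @[x --> F] --> (q x0)`_i.
  rewrite coef_map; under eq_fun do rewrite coef_map.
  apply: cvg_trans (e_cont (a := Q`_i) (x := x0)).
  by apply: cvg_app; exact: cvg_within.
have near_good : \forall x \near F, good x.
  have nd : \forall x \near x0, e x dl != 0.
    exact: (cvgr_neq0 _ (e_cont (a := dl) (x := x0))).
  by apply: filterS nd => x dx bx; split.
apply/cvgrPdist_lt => ep ep0.
set n := (size Q).-1.
(* There are [n] roots; dividing by [n.+1] keeps the total error strictly below [ep], also when [n]
   is 0. *)
pose ep' := ep / n.+1%:R.
have ep'0 : 0 < ep' by rewrite divr_gt0.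
have [d d0 dP] : exists2 d, 0 < d & forall y, y \in fibre_roots x0 ->
    \forall x \near F, forall y', `|y' - y| < d -> Z (x, y') ->
      `|phi (x, y') - phi (x0, y)| < ep'.
  apply: common_radius => [z d d' dd' H|y].
    by apply: filterS H => x Hx y' yd; apply: Hx; exact: lt_le_trans dd'.
  rewrite mem_fibre_roots// => ry; have [Zy hy] := good_roots gx0 ry.
  have cphi : phi @ within Z (nbhs (x0, y)) --> phi (x0, y).
    apply: (cvgM (fc Zy hy)); apply: cvg_trans (@eval_poly_continuous w (x0, y)).
    by apply: cvg_app; exact: cvg_within.
  have [[V1 V2] [/= nV1 /nbhs_ballP[d /= d0 dV2]] sub] :
      \forall z \near (x0, y), Z z -> `|phi z - phi (x0, y)| < ep'.
    exact: (cvg_near cphi ep'0).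
  exists d => //; apply: filterS nV1 => x V1x _ y' yy' Zxy.
  apply: sub => //; split => //=; apply: dV2.
  by rewrite -ball_normE /= distrC.
have near_d : \forall x \near F, forall i : 'I_n, forall y',
    `|y' - (fibre_roots x0)`_i| < d -> Z (x, y') ->
    `|phi (x, y') - phi (x0, (fibre_roots x0)`_i)| < ep'.
  apply: filter_forall => i; apply: dP.
  by rewrite mem_nth// size_fibre_roots.
apply: filterS3 near_good near_d (near_roots szq cq (good_neq0 gx0) (fibre_rootsE x0)
  (fibre_roots_uniq gx0) d0) => x gx nd [s [ss us qs sr]].
have sn : size s = n by rewrite ss size_fibre_roots.
have -> : fibre_trace w x = \sum_(i < n) phi (x, s`_i).
  rewrite /fibre_trace (perm_big s) /=.
    by rewrite (big_nth 0) big_mkord sn.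
  apply: uniq_perm => //; first exact: fibre_roots_uniq.
  move=> y; rewrite mem_fibre_roots// qs rootZ ?root_prod_XsubC//.
  by rewrite lead_coef_eq0 good_neq0.
have -> : fibre_trace w x0 = \sum_(i < n) phi (x0, (fibre_roots x0)`_i).
  by rewrite /fibre_trace (big_nth 0) big_mkord size_fibre_roots.
rewrite -sumrB (le_lt_trans (ler_norm_sum _ _ _))//.
apply: (@le_lt_trans _ _ (\sum_(i < n) ep')).
  apply: ler_sum => i _; rewrite distrC ltW//; apply: nd.
    by apply: sr; rewrite size_fibre_roots.
  have /(good_roots gx)[] // : root (q x) s`_i.
  rewrite qs rootZ ?root_prod_XsubC ?mem_nth ?sn//.
  by rewrite lead_coef_eq0 good_neq0.
rewrite sumr_const card_ord -mulr_natr /ep' mulrAC ltr_pdivrMr ?ltr0Sn//.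
by rewrite ltr_pM2l// ltr_nat.
Qed.

Lemma good_point : exists x, good x.
Proof.
by have [z Zz] := nvanishP ndl; rewrite eval_polyC => dz; exists z.1; split => //; exact: base_fst.
Qed.

Lemma trace_integral w : exists N, exists2 M, M \is monic &
  forall x, good x -> root (map_poly (e x) M) (e x (lead_coef Q) ^+ N * fibre_trace w x).
Proof.
have [x1 gx1] := good_point.
pose I : pointedType := pointed_at x1.
(* Bad points are redirected to the good point [x1], so that the equations hold at every index. *)
pose r (x : I) : T := if pselect (good x) then (x : T) else x1.
have gr x : good (r x) by rewrite /r; case: pselect.
have rE x : good x -> r x = x by rewrite /r; case: pselect.
set n := (size Q).-1.
pose y (j : nat) : I -> C := fun x => (fibre_roots (r x))`_j.
have ry j x : (j < n)%N -> root (q (r x)) (y j x).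
  by move=> jn; rewrite -mem_fibre_roots// mem_nth// size_fibre_roots.
pose g (j : nat) : I -> C := fun x => f (r x, y j x).
(* Integrality is proved branch by branch, for an arbitrary numbering of the roots, and then
   summed. *)
have gint (j : 'I_n) : exists N, integralOver (pull e r) (pull e r (lead_coef Q) ^+ N * g j).
  apply: (@integral_scaled_root _ _ _ e I r Q (y j) sQ _ P _
    (fun x => eval_poly (r x, y j x))) => //.
    by move=> x; exact: ry.
  by move=> x; have [] := good_roots (gr x) (ry _ x (ltn_ord j)) => Zx hx; exact: fP.
have [Nf gN] := choice gint.
pose N := ((\max_(j < n) Nf j) + size w)%N.
have : integralOver (pull e r) (pull e r (lead_coef Q) ^+ N * (fun x => fibre_trace w (r x))).
  have -> : pull e r (lead_coef Q) ^+ N * (fun x => fibre_trace w (r x)) =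
      \sum_(j < n) (pull e r (lead_coef Q) ^+ (\max_(j < n) Nf j) * g j) *
        (pull e r (lead_coef Q) ^+ size w * (fun x => (map_poly (e (r x)) w).[y j x])).
    apply/funext => x; rewrite fun_mulE fun_sumE /fibre_trace (big_nth 0) big_mkord.
    rewrite size_fibre_roots// mulr_sumr; apply: eq_bigr => j _.
    by rewrite !fun_mulE !fun_expE exprD -/(y j x) eval_polyE /g; ring.
  apply: integralOver_sum => j; apply: integral_mul; last first.
    by apply: integral_scaled_horner => // x; exact: ry.
  have -> : pull e r (lead_coef Q) ^+ (\max_(j < n) Nf j) * g j =
      pull e r (lead_coef Q) ^+ (\max_(j < n) Nf j - Nf j) * (pull e r (lead_coef Q) ^+ Nf j * g j).
    by rewrite mulrA -exprD subnK// (bigD1 j)//= leq_maxl.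
  apply: integral_mul => //; apply: integralOver_exp; exact: integral_id.
move=> /integral_pullP[M monM rM]; exists N, M => // x gx.
by have := rM x; rewrite fun_mulE fun_expE pullE rE.
Qed.

(** The induction hypothesis needs an integral function, so it is applied to the trace times a power
    of the leading coefficient, which is then divided out. *)
Lemma trace_rational w : generically_rational e base (fibre_trace w).
Proof.
have [N [M monM rM]] := trace_integral w.
have nlb : ~ vanish e base (lead_coef Q ^+ N).
  by apply: nvanishX => //; [exact: base_irreducible|rewrite vanish_base].
have nd : ~ vanish e base dl by rewrite vanish_base.
have [||g [p nq gE]] := ratA base_closed base_irreducible nd monM
    (f := fun x => e x (lead_coef Q) ^+ N * fibre_trace w x).
- move=> x bx dx; apply: cvgM; last by apply: trace_continuous.
  rewrite -rmorphXn; under eq_fun do rewrite -rmorphXn.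
  apply: cvg_trans (e_cont (a := lead_coef Q ^+ N) (x := x)).
  by apply: cvg_app; exact: cvg_within.
- by move=> x bx dx; apply: rM.
have r1 : generically_rational e base (fun x => e x (lead_coef Q) ^+ N * fibre_trace w x).
  by exists g, p.
have := rationalM base_irreducible r1 (rational_inv nlb).
apply: (rational_ext base_irreducible nlb) => x bx lx.
by rewrite rmorphXn mulrAC mulfV ?mul1r// -rmorphXn.
Qed.

End Trace.

Lemma finite_step : prational Z f.
Proof.
have [x1 bx1 lx1] : exists2 x, base x & e x (lead_coef Q) != 0.
  by apply: nvanishP => H; apply: nlQ; apply/vanish_base.
(* The derivative is shorter than [Q], so vanishing on [Z] would make it zero over the base, against
   characteristic 0 at a point where the leading coefficient is nonzero. *)
have nQ' : ~ pvanish Z Q^`().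
  move=> vQ'; have sQ' : (size Q^`() < size Q)%N by rewrite lt_size_deriv// relation_neq0.
  have /polyP/(_ (size Q).-2) := minQ vQ' sQ' bx1.
  rewrite coef_map coef_deriv coef0 /= rmorphMn /=; apply/eqP.
  rewrite mulrn_eq0 negb_or /=.
  suff -> : (size Q).-2.+1 = (size Q).-1 by rewrite -lead_coefE.
  by rewrite prednK// -ltnS prednK// ltnW.
have [rho nrho [u [v uv]]] := relation_bezout nQ'.
have [eta neta [u' [v' uv']]] := relation_bezout nh.
(* Where [dl] is nonzero, the leading coefficient keeps the degree, [rho] makes the roots simple,
   and [eta] keeps them off the zeros of [h]. *)
pose dl := lead_coef Q * rho * eta.
have ndl : ~ pvanish Z dl%:P.
  by rewrite /dl !polyCM; do 2![apply: nvanishM => //].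
have goodP x : e x dl != 0 -> [/\ e x (lead_coef Q) != 0, e x rho != 0 & e x eta != 0].
  by rewrite /dl !rmorphM !mulf_eq0 !negb_or -andbA => /and3P.
pose q x := map_poly (e x) Q.
have bez x g r a b : base x -> base_zero (a * Q + b * g - r%:P) ->
    map_poly (e x) a * q x + map_poly (e x) b * map_poly (e x) g = (e x r)%:P.
  move=> bx /(_ x bx); rewrite rmorphB rmorphD !rmorphM /= map_polyC /= => /eqP.
  by rewrite subr_eq0 => /eqP.
have good_lead x : base x /\ e x dl != 0 -> e x (lead_coef Q) != 0.
  by move=> [_ /goodP[]].
have good_sep x : base x /\ e x dl != 0 -> separable_poly (q x).
  move=> [bx /goodP[_ rx _]]; rewrite unlock; apply/Bezout_coprimepP.
  exists (map_poly (e x) u, map_poly (e x) v) => /=.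
  by rewrite {2}/q deriv_map (bez x _ _ _ _ bx uv) -alg_polyC; exact: eqp_scale.
have good_roots x : base x /\ e x dl != 0 -> forall y, root (q x) y ->
    Z (x, y) /\ eval_poly (x, y) h != 0.
  move=> [bx /goodP[lx _ ex]] y /rootP qy; split.
    (* Up to a power of the leading coefficient, [Q] divides every [p] vanishing on [Z], so each
       root of [q x] gives a point of [Z]. *)
    apply: clZ => p vp; have := relation_dvd vp bx.
    rewrite rmorphB rmorphM /= map_polyZ /= => /(congr1 (horner^~ y)).
    rewrite !hornerE -/(q x) qy mulr0 subr0 => /eqP.
    by rewrite mulf_eq0 rmorphXn /= expf_eq0 (negbTE lx) andbF => /eqP.
  apply: contraNneq ex => hy; have := bez x h eta u' v' bx uv'.
  move=> /(congr1 (horner^~ y)); rewrite eval_polyE in hy; rewrite !hornerE qy hy !mulr0 addr0.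
  by move=> <-.
have [d dE] := divided_difference Q.
pose dz z := map_poly (eval_poly z) d.
have dzE x y : q x - ((q x).[y])%:P = dz (x, y) * ('X - y%:P).
  have Xy : eval_poly (x, y) 'X = y by rewrite eval_polyE map_polyX hornerX.
  have := dE _ (eval_poly (x, y)); rewrite Xy => {Xy}; move=> <-; congr (_ - _).
  by apply: eq_map_poly => a; exact: esym (eval_polyC (x, y) a).
(* The aim is [rho * f = \sum_i c_i * y ^ i]. Expanding the traces, a root [y'] other than [y]
   contributes 0, and [y] itself contributes [f * v * Q'(y) = f * rho]. *)
pose c i := fibre_trace (v * d`_i).
have rc i : generically_rational e base (c i) by exact: (trace_rational ndl).
have rS : prational Z (fun z => \sum_(i < size d) c i z.1 * z.2 ^+ i).
  by apply: rational_sum => // i; exact: rational_y.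
apply: (@rational_ext _ _ _ _ _ irrZ _ _ dl%:P _ _ (rationalM irrZ (rational_inv nrho) rS)) => //.
move=> [x y] Zz; rewrite !eval_polyC => dx.
have [_ rx _] := goodP x dx; have gx : base x /\ e x dl != 0.
  by split=> //; exact: (base_fst Zz).
have qy : root (q x) y by rewrite rootE; apply/eqP; exact: (vQ Zz).
have yr : y \in fibre_roots x by rewrite (mem_fibre_roots good_lead gx).
have lagrange0 y' : root (q x) y' -> y' != y -> (dz (x, y')).[y] = 0.
  move=> qy' ne; have := dzE x y'; rewrite (rootP qy') subr0.
  move=> /(congr1 (horner^~ y)); rewrite (rootP qy) !hornerE => /esym/eqP.
  by rewrite mulf_eq0 subr_eq0 [y == y']eq_sym (negbTE ne) orbF => /eqP.
have lagrange1 : eval_poly (x, y) v * (dz (x, y)).[y] = e x rho.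
  have qd : q x = dz (x, y) * ('X - y%:P) by rewrite -dzE (rootP qy) subr0.
  have dq : (dz (x, y)).[y] = (q x)^`().[y].
    by rewrite qd derivM derivXsubC !hornerE subrr mulr0 add0r.
  rewrite dq; have := bez x _ _ _ _ (base_fst Zz) uv.
  move=> /(congr1 (horner^~ y)); rewrite !hornerE (rootP qy) mulr0 add0r => <-.
  by rewrite /q deriv_map.
have -> : \sum_(i < size d) c i x * y ^+ i =
    \sum_(y' <- fibre_roots x) f (x, y') * eval_poly (x, y') v * (dz (x, y')).[y].
  under eq_bigr do rewrite /c /fibre_trace mulr_suml.
  rewrite exchange_big; apply: eq_bigr => y' _.
  rewrite (@horner_coef_wide _ (size d)) ?size_poly// mulr_sumr.
  apply: eq_bigr => i _.
  have -> : (dz (x, y'))`_i = eval_poly (x, y') d`_i by rewrite coef_map.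
  have -> := rmorphM (eval_poly (x, y')) v d`_i.
  by rewrite !mulrA.
rewrite (bigD1_seq y) ?(fibre_roots_uniq good_lead good_sep)//= big_seq_cond big1.
  by rewrite addr0 -mulrA lagrange1 mulrC mulfK.
move=> y' /andP[]; rewrite (mem_fibre_roots good_lead gx) => ry' ne.
by rewrite lagrange0// mulr0.
Qed.

End MinimalRelation.

End Step.

Lemma add_variable_rational :
  @continuous_algebraic_rational C {poly A} (T * C)%type eval_poly.
Proof.
move=> Z f h P clZ irrZ nh monP fc fP.
have [cyl|ncyl] := pselect (forall p, pvanish Z p -> forall i, pvanish Z (p`_i)%:P).
  exact: (cylinder_step clZ irrZ nh monP fc fP cyl).
have [Q [vQ nlQ sQ minQ]] := minimal_relation ncyl.
exact: (finite_step clZ irrZ nh monP fc fP vQ nlQ sQ minQ).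
Qed.

End AddVariable.

(** * Polynomials in n variables *)

(** All notions involved depend only on values at points, so compatibility of [phi] and [psi] with
    evaluation carries the statement across. *)
Lemma rational_transport (C : numClosedFieldType) (A B : idomainType)
    (S T : topologicalType) (eA : S -> {rmorphism A -> C}) (eB : T -> {rmorphism B -> C})
    (phi : {rmorphism B -> A}) (psi : {rmorphism A -> B}) (j : S -> T) (j' : T -> S) :
  continuous j -> cancel j' j ->
  (forall s b, eA s (phi b) = eB (j s) b) -> (forall s a, eB (j s) (psi a) = eA s a) ->
  continuous_algebraic_rational eA -> continuous_algebraic_rational eB.
Proof.
move=> jc jK phiE psiE ratA Z f h P clZ irrZ nh monP fc fP.
pose Z' : set S := j @^-1` Z.
have vphi b : vanish eB Z b <-> vanish eA Z' (phi b).
  split=> [vb s Zs|vb z Zz]; first by rewrite phiE vb.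
  by rewrite -(jK z) -phiE vb// /Z' /= jK.
have vpsi a : vanish eA Z' a <-> vanish eB Z (psi a).
  split=> [va z Zz|va s Zs]; last by rewrite -psiE va.
  by rewrite -(jK z) psiE va// /Z' /= jK.
have [||||||p [q nq fq]] := ratA Z' (f \o j) (phi h) (map_poly phi P).
- by move=> s vs; apply: clZ => b /vphi /vs; rewrite phiE.
- split; first by rewrite vpsi rmorph1; exact: irrZ.1.
  by move=> a a'; rewrite !vpsi rmorphM; exact: irrZ.2.
- by rewrite -vphi.
- exact: monic_map.
- move=> s Zs; rewrite phiE => hs U /(fc _ Zs hs) nU.
  have nV : \forall z \near j s, Z z -> U (f z) by exact: nU.
  suff : \forall s' \near s, Z' s' -> U (f (j s')) by [].
  exact: (jc s _ nV).
- move=> s Zs; rewrite phiE => hs; rewrite -map_poly_comp.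
  by rewrite (eq_map_poly (g := eB (j s))); [exact: fP|move=> b; exact: phiE].
exists (psi p), (psi q); first by rewrite -vpsi.
move=> z Zz; rewrite -(jK z) !psiE => q0.
by apply: fq => //; rewrite /Z' /= jK.
Qed.

Section MultivariateEvaluation.
Variable C : numClosedFieldType.

Definition mev n (x : 'rV[C]_n) : {rmorphism (mpoly.mpoly n C) -> C} :=
  mpoly.meval (x ord0).

Lemma mevE n (x : 'rV[C]_n) p : mev x p = mpoly.meval (x ord0) p.
Proof. by []. Qed.

Lemma mev_const n (x : 'rV[C]_n) c : mev x (mpoly.mpolyC n c) = c.
Proof. by rewrite mevE mpoly.mevalC. Qed.

Lemma mev_continuous n (p : mpoly.mpoly n C) : continuous (fun x : 'rV[C]_n => mev x p).
Proof.
move=> x; rewrite /continuous_at mevE mpoly.mevalE.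
under eq_fun do rewrite mevE mpoly.mevalE.
apply: (@cvg_big _ _ _ _ _ _ _ (nbhs x)) => [|m _]; first exact: add_continuous.
apply: (@cvgM _ _ (nbhs x)); first exact: cvg_cst.
apply: (@cvg_big _ _ _ _ _ _ _ (nbhs x)) => [|i _]; first exact: mul_continuous.
elim: (mpoly.fun_of_multinom m i) => [|k IH].
  by under eq_fun do rewrite expr0; exact: cvg_cst.
rewrite exprS; under eq_fun do rewrite exprS.
by apply: (@cvgM _ _ (nbhs x)) => //; exact: coord_continuous.
Qed.

Definition extend n (z : 'rV[C]_n * C) : 'rV[C]_n.+1 :=
  \row_(i < n.+1) if insub (i : nat) is Some k then z.1 ord0 k else z.2.

Definition shrink n (v : 'rV[C]_n.+1) : 'rV[C]_n * C :=
  (\row_(i < n) v ord0 (widen_ord (leqnSn n) i), v ord0 ord_max).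

Lemma extend_widen n z i : @extend n z ord0 (widen_ord (leqnSn n) i) = z.1 ord0 i.
Proof. by rewrite mxE /= valK. Qed.

Lemma extend_max n z : @extend n z ord0 ord_max = z.2.
Proof. by rewrite mxE insubF// ltnn. Qed.

Lemma shrinkK n : cancel (@shrink n) (@extend n).
Proof.
move=> v; apply/rowP => i; rewrite mxE.
case: insubP => [k _ ki|]; first by rewrite mxE; congr (v _ _); exact: val_inj.
rewrite -leqNgt => ni; congr (v _ _); apply: val_inj => /=.
by apply/eqP; rewrite eqn_leq ni -ltnS ltn_ord.
Qed.

Lemma extend_continuous n : continuous (@extend n).
Proof.
move=> z; apply/cvg_ballP => e e0.
have nf (i : 'I_n.+1) : \forall w \near z, ball (extend z ord0 i) e (extend w ord0 i).
  rewrite mxE; case: insubP => [l _ li|ni].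
    have c1 : (fun w : 'rV[C]_n * C => w.1 ord0 l) @ z --> z.1 ord0 l.
      apply: (@cvg_comp _ _ _ fst (fun x : 'rV[C]_n => x ord0 l)); first exact: cvg_fst.
      exact: coord_continuous.
    move/cvg_ballP : c1 => /(_ e e0); apply: filterS => w.
    by rewrite mxE -li valK.
  have c1 : (fun w : 'rV[C]_n * C => w.2) @ z --> z.2 by exact: cvg_snd.
  move/cvg_ballP : c1 => /(_ e e0); apply: filterS => w.
  by rewrite mxE insubF//; exact: negbTE.
have nfa : \forall w \near z, forall i, ball (extend z ord0 i) e (extend w ord0 i).
  exact: (@filter_forall _ _ _ (nbhs z) _ nf).
apply: filterS nfa => w H; split=> // i' i.
by rewrite [i']ord1; exact: H.
Qed.

Lemma ev_muni n (z : 'rV[C]_n * C) (p : mpoly.mpoly n.+1 C) :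
  eval_poly (@mev n) z (mpoly.muni p) = mev (extend z) p.
Proof.
rewrite -[LHS]/((map_poly (mev z.1) (mpoly.muni p)).[z.2]) mpoly.muniE mevE mpoly.mevalE.
rewrite rmorph_sum horner_sum; apply: eq_bigr => m _.
rewrite -[X in X.[_]]/(map_poly (mev z.1) _) map_polyZ hornerZ map_polyXn hornerXn.
rewrite mevE mpoly.mevalZ mpoly.mevalX big_ord_recr extend_max -mulrA.
congr (_ * (_ * _)).
by apply: eq_bigr => i _; rewrite extend_widen mpoly.mnmE.
Qed.

Definition mpoly_join n : {rmorphism {poly (mpoly.mpoly n C)} -> mpoly.mpoly n.+1 C} :=
  (horner_eval (mpoly.mpolyX C (mpoly.mnm1 ord_max)) \o map_poly (@mpoly.mwiden n C)).

Lemma mev_widen n (z : 'rV[C]_n * C) (p : mpoly.mpoly n C) :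
  mev (extend z) (mpoly.mwiden p) = mev z.1 p.
Proof.
rewrite !mevE /mpoly.mwiden /mpoly.mmap rmorph_sum mpoly.mevalE; apply: eq_bigr => m _.
rewrite rmorphM /= mpoly.mevalC; congr (_ * _).
rewrite /mpoly.mmap1 rmorph_prod; apply: eq_bigr => i _.
by rewrite rmorphXn /= mpoly.mevalXU extend_widen.
Qed.

Lemma ev_join n (z : 'rV[C]_n * C) (p : {poly (mpoly.mpoly n C)}) :
  mev (extend z) (mpoly_join n p) = eval_poly (@mev n) z p.
Proof.
rewrite -[LHS]horner_map -map_poly_comp.
rewrite -[RHS]/((map_poly (mev z.1) p).[z.2]) /= mevE mpoly.mevalXU extend_max.
congr (_.[_]); apply: eq_map_poly => a; exact: mev_widen.
Qed.

Lemma mev_rational : punctures_connected C ->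
  forall n, @continuous_algebraic_rational C (mpoly.mpoly n C) 'rV[C]_n (@mev n).
Proof.
move=> conn; elim=> [|n IH].
  apply: (@one_point_rational _ _ _ _ (@mpoly.mpolyC 0 C)); first exact: mev_const.
  by move=> x y; apply/rowP => -[].
apply: (rational_transport (@extend_continuous n) (@shrinkK n) (phi := @mpoly.muni n C)
  (psi := mpoly_join n) (eA := eval_poly (@mev n))).
- exact: ev_muni.
- exact: ev_join.
apply: (add_variable_rational conn _ (k := @mpoly.mpolyC n C)) => //.
- exact: mev_continuous.
- exact: mev_const.
Qed.
End MultivariateEvaluation.

(** * Hilbert's basis theorem *)

Definition is_ideal (A : comNzRingType) (I : A -> Prop) : Prop :=
  [/\ I 0, forall a b, I a -> I b -> I (a + b) & forall a b, I b -> I (a * b)].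

(** The intersection of all ideals containing [s], which spares explicit linear combinations. *)
Definition ideal_span (A : comNzRingType) (s : seq A) (a : A) : Prop :=
  forall I, is_ideal I -> (forall b, b \in s -> I b) -> I a.

Definition noetherian (A : comNzRingType) : Prop :=
  forall I : A -> Prop, is_ideal I ->
  exists2 s : seq A, (forall a, a \in s -> I a) & forall a, I a -> ideal_span s a.

Lemma ideal_span_ideal (A : comNzRingType) (s : seq A) : is_ideal (ideal_span s).
Proof.
split=> [I [I0 _ _] _//|a b sa sb I idI sI|a b sb I idI sI].
  by case: (idI) => _ + _; apply; [exact: sa|exact: sb].
by case: (idI) => _ _; apply; exact: sb.
Qed.

Lemma ideal_opp (A : comNzRingType) (I : A -> Prop) a : is_ideal I -> I a -> I (- a).
Proof. by case=> _ _ IM Ia; rewrite -mulN1r; exact: IM. Qed.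

Lemma ideal_span_mem (A : comNzRingType) (s : seq A) a : a \in s -> ideal_span s a.
Proof. by move=> sa I _; apply. Qed.

Lemma field_noetherian (F : fieldType) : noetherian F.
Proof.
move=> I [I0 _ IM]; have [[a Ia a0]|nI] := pselect (exists2 a, I a & a != 0).
  exists [:: a]; first by move=> b; rewrite inE => /eqP->.
  move=> b _ K [_ _ KM] sK; rewrite -[b](divfK a0); apply: KM; apply: sK.
  exact: mem_head.
exists [::] => // a Ia K [K0 _ _] _; have [->//|a0] := eqVneq a 0.
by case: nI; exists a.
Qed.

Lemma noetherian_surj (A B : comNzRingType) (psi : {rmorphism A -> B}) :
  (forall b, exists a, psi a = b) -> noetherian A -> noetherian B.
Proof.
move=> surj nA I idI.
have pull_ideal (K : B -> Prop) : is_ideal K -> is_ideal (fun a => K (psi a)).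
  case=> K0 KD KM; split; rewrite ?rmorph0//.
    by move=> a b Ka Kb; rewrite rmorphD; exact: KD.
  by move=> a b Kb; rewrite rmorphM; exact: KM.
have [s sI Is] := nA _ (pull_ideal _ idI).
exists (map psi s); first by move=> _ /mapP[a sa ->]; exact: sI.
move=> b; have [a <-] := surj b => /Is sa K idK sK.
by apply: (sa _ (pull_ideal _ idK)) => c cs; apply: sK; exact: map_f.
Qed.

Lemma size_cancel (A : nzRingType) (p g : {poly A}) d :
  (size p <= d.+1)%N -> (size g <= d.+1)%N -> g`_d = p`_d -> (size (p - g)%R <= d)%N.
Proof.
move=> sp sg gp; apply/leq_sizeP => j; rewrite leq_eqVlt => /predU1P[<-|dj].
  by rewrite coefB gp subrr.
by rewrite coefB !nth_default ?subrr// (leq_trans _ dj).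
Qed.

Lemma poly_noetherian (A : comNzRingType) : noetherian A -> noetherian {poly A}.
Proof.
move=> nA J idJ; have [J0 JD JM] := idJ.
(* The ideal of coefficients of degree [d] of members of degree at most [d]; it grows with [d], and
   its union over [d] is finitely generated, hence attained at some [N]. *)
pose L (K : {poly A} -> Prop) d a := exists p, [/\ K p, (size p <= d.+1)%N & p`_d = a].
have L_ideal K d : is_ideal K -> is_ideal (L K d).
  case=> K0 KD KM; split; first by exists 0; rewrite size_poly0 coef0.
    move=> _ _ [p [Kp sp <-]] [q [Kq sq <-]]; exists (p + q); split; first exact: KD.
      by rewrite (leq_trans (size_polyD _ _))// geq_max sp.
    by rewrite coefD.
  move=> a _ [p [Kp sp <-]]; exists (a%:P * p); split; first exact: KM.
    by rewrite mul_polyC (leq_trans (size_scale_leq _ _)).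
  by rewrite coefCM.
have L_add d k a : L J d a -> L J (k + d)%N a.
  case=> p [Jp sp <-]; exists ('X^k * p); split; first exact: JM.
    have [->|p0] := eqVneq p 0; first by rewrite mulr0 size_poly0.
    by rewrite mulrC size_mulXn// -addnS leq_add2l.
  by rewrite coefXnM ltnNge leq_addr /= addKn.
have L_mono d d' a : (d <= d')%N -> L J d a -> L J d' a.
  by move=> dd'; rewrite -(subnK dd'); exact: L_add.
have [s0 s0L Ls0] : exists2 s, (forall a, a \in s -> exists d, L J d a) &
    forall a, (exists d, L J d a) -> ideal_span s a.
  apply: nA; split; first by exists 0%N; case: (L_ideal J 0%N idJ).
    move=> a b [d La] [d' Lb]; exists (d + d')%N.
    case: (L_ideal J (d + d')%N idJ) => _ + _; apply.
      by apply: L_mono La; exact: leq_addr.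
    by apply: L_mono Lb; exact: leq_addl.
  by move=> a b [d Lb]; exists d; case: (L_ideal J d idJ) => _ _; apply.
have [N LN] : exists N, forall a, a \in s0 -> L J N a.
  elim: s0 s0L {Ls0} => [|b s IH] sL; first by exists 0%N.
  have [|N HN] := IH; first by move=> a sa; apply: sL; rewrite inE sa orbT.
  have [d Ld] := sL b (mem_head _ _); exists (N + d)%N => a.
  rewrite inE => /predU1P[->|/HN]; first exact: (L_mono d _ _ (leq_addl _ _)).
  exact: (L_mono N _ _ (leq_addr _ _)).
have LdN d a : L J d a -> L J N a.
  by move=> Lda; apply: (Ls0 a (ex_intro _ d Lda) _ (L_ideal J N idJ)).
have gen d : exists S : seq {poly A}, (forall p, p \in S -> J p) /\
    forall a, L J d a -> L (ideal_span S) d a.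
  have [s sL Ls] := nA _ (L_ideal J d idJ).
  have [S SJ sS] : exists2 S : seq {poly A}, (forall p, p \in S -> J p) &
      forall a, a \in s -> L (ideal_span S) d a.
    elim: s sL {Ls} => [|b s IH] sL; first by exists [::].
    have [|S SJ sS] := IH; first by move=> a sa; apply: sL; rewrite inE sa orbT.
    have [p [Jp sp pb]] := sL b (mem_head _ _).
    exists (p :: S); first by move=> q; rewrite inE => /predU1P[->|/SJ].
    move=> a; rewrite inE => /predU1P[->|/sS [q [Sq sq qa]]].
      by exists p; split=> //; apply: ideal_span_mem; exact: mem_head.
    exists q; split=> // I idI SI; apply: Sq => // r rS; apply: SI.
    by rewrite inE rS orbT.
  exists S; split=> // a La; apply: (Ls a La) sS.
  by apply: L_ideal; exact: ideal_span_ideal.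
have [S SP] := choice gen.
pose G := flatten [seq S d | d <- iota 0 N.+1].
have SG d a : (d <= N)%N -> L (ideal_span (S d)) d a -> L (ideal_span G) d a.
  move=> dN [p [Sp sp pa]]; exists p; split=> // I idI GI; apply: Sp => // r rS.
  apply: GI; apply/flatten_mapP; exists d => //.
  by rewrite mem_iota add0n.
have GJ p : p \in G -> J p by case/flatten_mapP => d _; exact: (SP d).1.
exists G => // p; have [n] := ubnP (size p); elim: n p => // n IH p pn Jp.
have [idG0 idGD idGM] := ideal_span_ideal G.
have [->//|p0] := eqVneq p 0.
pose d := (size p).-1; have sp : size p = d.+1 by rewrite prednK// size_poly_gt0.
(* A combination of the generators with the same top coefficient as [p]; beyond degree [N] it is
   obtained from degree [N] by a shift. Subtracting it lowers the size. *)
have [g [Gg sg gd]] : L (ideal_span G) d p`_d.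
  have Lp : L J d p`_d by exists p; rewrite sp.
  have [dN|Nd] := leqP d N; first by apply: SG => //; exact: (SP d).2.
  have [g [Gg sg gd]] := SG _ _ (leqnn N) ((SP N).2 _ (LdN _ _ Lp)).
  exists ('X^(d - N) * g); split; first exact: idGM.
    have [->|g0] := eqVneq g 0; first by rewrite mulr0 size_poly0.
    by rewrite mulrC size_mulXn// -{2}(subnK (ltnW Nd)) -addnS leq_add2l.
  by rewrite coefXnM ltnNge leq_subr /= subKn// ltnW.
rewrite -(subrK g p); apply: idGD => //; apply: IH.
  rewrite -ltnS (leq_trans _ pn)// sp !ltnS.
  by apply: size_cancel => //; rewrite sp.
by apply: JD => //; apply: ideal_opp => //; exact: Gg.
Qed.

Section MpolyNoetherian.
Variable C : numClosedFieldType.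

Lemma mpoly_joinK n (p : mpoly.mpoly n.+1 C) : mpoly_join C n (mpoly.muni p) = p.
Proof.
rewrite mpoly.muniE rmorph_sum [RHS]mpoly.mpolyE; apply: eq_bigr => m _.
rewrite -[LHS]/((map_poly (@mpoly.mwiden n C) _).[_]).
rewrite map_polyZ hornerZ map_polyXn hornerXn /= mpoly.mwidenZ -scalerAl.
congr (_ *: _); rewrite [RHS]mpoly.mpolyXE_id big_ord_recr /=; congr (_ * _).
rewrite mpoly.mpolyXE_id rmorph_prod; apply: eq_bigr => i _.
by rewrite rmorphXn /= mpoly.mwidenX mpoly.mnmwiden1 mpoly.mnmE.
Qed.

Lemma mpoly_noetherian n : noetherian (mpoly.mpoly n C).
Proof.
elim: n => [|n IH].
  apply: (noetherian_surj (psi := @mpoly.mpolyC 0 C)); last exact: field_noetherian.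
  by move=> b; eexists; exact: esym (mpoly.nvar0_mpolyC b).
apply: (noetherian_surj (psi := mpoly_join C n)); last exact: poly_noetherian.
by move=> b; exists (mpoly.muni b); exact: mpoly_joinK.
Qed.

End MpolyNoetherian.

(** * The Zariski topology of C^n *)

Section ZariskiTopology.
Variables (R : realType) (n : nat).
Local Notation C := (CC R).
Implicit Types (X Y Z W : set 'rV[C]_n) (p q : Cpoly R n).

Lemma zariski_closedI X Y : zariski_closed X -> zariski_closed Y ->
  zariski_closed (X `&` Y).
Proof.
move=> [S ->] [S' ->]; exists (S `|` S'); apply/seteqP; split=> x /=.
  by move=> [Sx S'x] p [/Sx|/S'x].
by move=> SS'x; split=> p Sp; apply: SS'x; [left|right].
Qed.

Lemma zariski_closedU X Y : zariski_closed X -> zariski_closed Y ->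
  zariski_closed (X `|` Y).
Proof.
move=> [S ->] [S' ->].
exists [set r | exists p q, [/\ S p, S' q & r = p * q]]; apply/seteqP; split=> x /=.
  move=> H r [p [q [Sp S'q ->]]]; rewrite /ev rmorphM /=.
  by case: H => [/(_ p Sp)|/(_ q S'q)]; rewrite /ev => ->; rewrite ?mul0r ?mulr0.
move=> H; have [Sx|nS] := pselect (zero_locus S x); first by left.
right=> q S'q; apply: contrapT => qx; apply: nS => p Sp.
have /H : [set r | exists p q, [/\ S p, S' q & r = p * q]] (p * q) by exists p, q.
rewrite /ev rmorphM /= => /eqP; rewrite mulf_eq0 => /orP[/eqP//|/eqP].
by rewrite -/(ev q x) => /qx.
Qed.

Lemma zariski_closed1 p : zariski_closed [set x | ev p x = 0].
Proof.
exists [set p]; apply/seteqP; split=> x /=; first by move=> px q ->.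
by apply.
Qed.

Lemma zariski_closed_ideal X : zariski_closed X ->
  forall x, (forall p, vanishing_ideal X p -> ev p x = 0) -> X x.
Proof. by move=> [S ->] x H p Sp; apply: H => y; apply. Qed.

(** Otherwise choice gives a strictly decreasing sequence of closed sets. The union of their
    vanishing ideals is finitely generated, hence equal to the ideal of some [Ys K], and then [Ys K]
    lies in [Ys K.+1]. *)
Lemma zariski_minimal (Fam : set (set 'rV[C]_n)) :
  Fam !=set0 -> (forall Y, Fam Y -> zariski_closed Y) ->
  exists2 Y, Fam Y & forall Y', Fam Y' -> Y' `<=` Y -> Y `<=` Y'.
Proof.
move=> [Y0 F0] Fcl; apply: contrapT => nmin.
have next Y : exists Y', Fam Y -> [/\ Fam Y', Y' `<=` Y & ~ Y `<=` Y'].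
  have [FY|] := pselect (Fam Y); last by exists Y.
  apply: contrapT => H; apply: nmin; exists Y => // Y' FY' Y'Y.
  by apply: contrapT => nYY'; apply: H; exists Y'.
have [g gP] := choice next.
pose Ys k := iter k g Y0.
have FYs k : Fam (Ys k) by elim: k => //= k /gP[].
have decr k l : (k <= l)%N -> Ys l `<=` Ys k.
  move=> /subnK <-; elim: (l - k)%N => // m IH x.
  rewrite addSn /Ys /= => Yx; apply: IH.
  by have [_ sub _] := gP _ (FYs (m + k)%N); exact: sub.
pose I (p : Cpoly R n) := exists k, vanishing_ideal (Ys k) p.
have idI : is_ideal I.
  split; first by exists 0%N => x _; rewrite /ev rmorph0.
    move=> a b [k va] [l vb]; exists (k + l)%N => x Yx.
    rewrite /ev rmorphD /= -!/(ev _ x) va ?vb ?addr0//.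
      exact: (decr _ _ (leq_addl k l)).
    exact: (decr _ _ (leq_addr l k)).
  by move=> a b [k vb]; exists k => x Yx; rewrite /ev rmorphM /= -!/(ev _ x) vb// mulr0.
have [s sI Is] := mpoly_noetherian idI.
have [K sK] : exists K, forall p, p \in s -> vanishing_ideal (Ys K) p.
  elim: s sI {Is} => [|p s IH] sI; first by exists 0%N.
  have [|K HK] := IH; first by move=> q qs; apply: sI; rewrite inE qs orbT.
  have [k vp] := sI p (mem_head _ _); exists (k + K)%N => q.
  rewrite inE => /predU1P[->|qs] x Yx.
    by apply: vp; exact: (decr _ _ (leq_addr K k)).
  by apply: HK => //; exact: (decr _ _ (leq_addl k K)).
have idK : is_ideal (vanishing_ideal (Ys K)).
  split; first by move=> x _; rewrite /ev rmorph0.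
    by move=> a b va vb x Yx; rewrite /ev rmorphD /= -!/(ev _ x) va ?vb ?addr0.
  by move=> a b vb x Yx; rewrite /ev rmorphM /= -!/(ev _ x) vb ?mulr0.
have [_ _] := gP _ (FYs K); apply=> x Yx.
apply: (zariski_closed_ideal (Fcl _ (FYs K.+1))) => p vp.
by apply: (Is p _ _ idK sK) => //; exists K.+1.
Qed.

(* A minimal closed set among those containing a nonempty open piece of X
   outside Z is an irreducible component of X. *)
Lemma component_in_open X Z : zariski_closed X -> zariski_closed Z -> ~ X `<=` Z ->
  exists Y W, [/\ irreducible_component X Y, zariski_closed Y, zariski_closed W,
    ~ X `<=` W & X `\` W `<=` Y `\` Z].
Proof.
move=> clX clZ nXZ.
pose Fam Y := [/\ zariski_closed Y, Y `<=` X &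
  exists W, [/\ zariski_closed W, ~ X `<=` W & X `\` W `<=` Y `\` Z]].
have [||Y [clY YX [W [clW nXW sub]]] minY] := @zariski_minimal Fam.
- exists X; split=> //; exists Z; split=> //.
- by move=> Y [].
have [x0 Xx0 nWx0] : exists2 x, X x & ~ W x.
  apply: contrapT => H; apply: nXW => x Xx; apply: contrapT => nWx.
  by apply: H; exists x.
exists Y, W; split=> //.
have irrY : zariski_irreducible Y.
  split; first by exists x0; have [] := sub x0 (conj Xx0 nWx0).
  move=> A B clA clB YAB.
  (* If the open piece lies in [A], then [Y] cut by [A] is still in the family. If not, removing [A]
     leaves a nonempty open piece, contained in [B]. *)
  have [XWA|nXWA] := pselect (X `\` W `<=` A).
    left; have /minY : Fam (Y `&` A).
      split; [exact: zariski_closedI|by move=> x [/YX]|].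
      exists W; split=> // x XWx; have [Yx nZx] := sub x XWx.
      by do !split=> //; exact: XWA.
    by move=> H x Yx; have [] := H (@subIsetl _ _ _) x Yx.
  right; have /minY : Fam (Y `&` B).
    split; [exact: zariski_closedI|by move=> x [/YX]|].
    exists (W `|` A); split; first exact: zariski_closedU.
      move=> XWA; apply: nXWA => x [Xx nWx].
      by have [] := XWA x Xx.
    move=> x [Xx /not_orP[nWx nAx]]; have [Yx nZx] := sub x (conj Xx nWx).
    by do !split=> //; have [] := YAB x Yx.
  by move=> H x Yx; have [] := H (@subIsetl _ _ _) x Yx.
split=> // Y' Y'X [_ irrY'] YY'; apply/seteqP; split=> //.
(* A larger irreducible [Y'] is covered by [W] and [Y], and it is not inside [W] because it contains
   [x0]. *)
have [|Y'W|//] := irrY' W Y clW clY.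
  move=> x /Y'X Xx; have [Wx|nWx] := pselect (W x); first by left.
  by right; have [] := sub x (conj Xx nWx).
by have [Yx0 _] := sub x0 (conj Xx0 nWx0); case: nWx0; apply/Y'W/YY'.
Qed.

Lemma zariski_irreducibleM Y p q : zariski_irreducible Y ->
  vanishing_ideal Y (p * q) -> vanishing_ideal Y p \/ vanishing_ideal Y q.
Proof.
move=> [_ irrY] vpq; apply: (irrY _ _ (zariski_closed1 p) (zariski_closed1 q)) => x Yx.
have /eqP := vpq x Yx; rewrite /ev rmorphM mulf_eq0 => /orP[]/eqP; [left|right] => //.
Qed.

(** [m] is the degree of the restriction of [P] to [Y]: higher coefficients may be nonzero
    polynomials as long as they vanish on [Y]. *)
Lemma top_coefficient (P : {poly Cpoly R n}) Y : nonzero_restriction Y P ->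
  exists2 m, ~ vanishing_ideal Y P`_m & forall i, (m < i)%N -> vanishing_ideal Y P`_i.
Proof.
move=> [k nk]; have [j] := ubnP (size P - k)%N.
elim: j k nk => // j IH k nk kj.
have [[i ki ni]|H] := pselect (exists2 i, (k < i)%N & ~ vanishing_ideal Y P`_i).
  apply: (IH i ni); rewrite -ltnS (leq_trans _ kj)// ltnS ltn_sub2l//.
  rewrite ltnNge; apply/negP => sk; apply: nk.
  by rewrite nth_default// => x _; rewrite /ev rmorph0.
by exists k => // i ki; apply: contrapT => ni; apply: H; exists i.
Qed.

Lemma algebraic_rational_irreducible Y (f : 'rV[C]_n -> C) (P : {poly Cpoly R n}) :
  zariski_closed Y -> zariski_irreducible Y -> {within Y, continuous f} ->
  nonzero_restriction Y P -> (forall x, Y x -> eval_at P x (f x) = 0) ->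
  exists p q : Cpoly R n, ~ vanishing_ideal Y q /\
    forall x, Y x -> ev q x != 0 -> f x = ev p x / ev q x.
Proof.
move=> clY irrY fc nzP fP; have [m nm vm] := top_coefficient nzP.
pose b := P`_m.
have irr : @alg_irreducible C (Cpoly R n) 'rV[C]_n (@mev C n) Y.
  split; last by move=> p q; exact: zariski_irreducibleM.
  have [[x Yx] _] := irrY; move=> /(_ x Yx) /eqP.
  by rewrite rmorph1 oner_eq0.
have fsum x : Y x -> \sum_(i < m) ev P`_i x * f x ^+ i = - (ev b x * f x ^+ m).
  move=> Yx; have := fP x Yx; rewrite /eval_at -[map_poly _ P]/(map_poly (mev x) P).
  have sP : (size (map_poly (mev x) P) <= m.+1)%N.
    by apply/leq_sizeP => i mi; rewrite coef_map; exact: vm.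
  rewrite (horner_coef_wide _ sP) big_ord_recr /= coef_map /= => /eqP.
  rewrite addr_eq0 => /eqP <-; apply: eq_bigr => i _.
  by rewrite coef_map.
have m0 : (0 < m)%N.
  rewrite lt0n; apply/eqP => m0; apply: nm => x Yx; have := fsum x Yx.
  by rewrite /b m0 big_ord0 expr0 mulr1 => /esym/eqP; rewrite oppr_eq0 => /eqP.
(* Multiplying the equation of [f] by [b ^+ m.-1] gives a monic equation for [b * f], which is
   continuous on all of [Y], so [h = 1] can be taken. *)
pose N : {poly Cpoly R n} := \poly_(i < m) (P`_i * b ^+ (m.-1 - i)).
pose M : {poly Cpoly R n} := 'X^m + N.
have monM : M \is monic.
  by rewrite monicE lead_coefDl ?lead_coefXn// size_polyXn ltnS size_poly.
have [|||p [q nq fq]] := mev_rational (@punctured_plane_connected R) (Z := Y)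
    (f := fun x => ev b x * f x) (h := 1) _ irr irr.1 monM.
- exact: zariski_closed_ideal.
- move=> x Yx _; apply: cvgM.
    apply: cvg_trans (@mev_continuous C n b x).
    by apply: cvg_app; exact: cvg_within.
  by move/subspace_continuousP : fc; apply.
- move=> x Yx _; rewrite rootE rmorphD /= map_polyXn hornerD hornerXn.
  have sM : (size (map_poly (mev x) N) <= m)%N.
    by rewrite (leq_trans (size_poly _ _))// size_poly.
  rewrite (horner_coef_wide _ sM) exprMn.
  have -> : \sum_(i < m) (map_poly (mev x) N)`_i *
      (ev b x * f x) ^+ i = ev b x ^+ m.-1 * \sum_(i < m) ev P`_i x * f x ^+ i.
    rewrite mulr_sumr; apply: eq_bigr => i _.
    have -> : (map_poly (mev x) N)`_i = ev P`_i x * ev b x ^+ (m.-1 - i).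
      by rewrite coef_map coef_poly ltn_ord /= mpoly.mevalM rmorphXn.
    rewrite exprMn.
    have -> : ev b x ^+ m.-1 = ev b x ^+ (m.-1 - i) * ev b x ^+ i.
      by rewrite -exprD subnK// -ltnS prednK.
    by ring.
  by rewrite fsum// mulrN mulrA -exprSr prednK// subrr.
exists p, (q * b); split.
  by move=> /(zariski_irreducibleM irrY)[].
move=> x Yx; have -> : ev (q * b) x = ev q x * ev b x by rewrite /ev rmorphM.
rewrite mulf_eq0 negb_or => /andP[qx bx].
have H : ev b x * f x = ev p x / ev q x by exact: fq.
by rewrite -[f x](mulKf bx) H invfM; ring.
Qed.

End ZariskiTopology.

Theorem theorem4p17 (R : realType) (n : nat) (X : set 'rV[CC R]_n)
    (f : 'rV[CC R]_n -> CC R) :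
  zariski_closed X ->
  {within X, continuous f} ->
  (exists P : {poly Cpoly R n},
     (forall Xi, irreducible_component X Xi -> nonzero_restriction Xi P) /\
     (forall x, X x -> eval_at P x (f x) = 0)) ->
  K0 X f.
Proof.
move=> clX fc [P [nzP fP]]; split=> //.
(* Open pieces on which a single fraction represents [f]; their union is the domain of
   regularity. *)
pose good V := zariski_open_in X V /\ exists p q : Cpoly R n,
  forall y, V y -> ev q y != 0 /\ f y = ev p y / ev q y.
exists [set x | exists2 V, good V & V x]; split.
- exists (zero_locus [set r | exists2 S, good (X `\` zero_locus S) & S r]).
    by exists [set r | exists2 S, good (X `\` zero_locus S) & S r].
  apply/seteqP; split=> x /=.
    move=> [V gV Vx]; have [[_ [S ->] VE] _] := gV.
    move: gV Vx; rewrite VE => gV [Xx nSx]; split=> // H; apply: nSx => p Sp.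
    by apply: H; exists S.
  move=> [Xx nx]; apply: contrapT => nV; apply: nx => r [S gS Sr].
  apply: contrapT => rx; apply: nV; exists (X `\` zero_locus S) => //.
  by split=> // /(_ r Sr).
(* Density: if [Z] missed part of [X], some open piece of [X] outside [Z] would lie in one
   component; there [f] is a fraction off the zeros of [q], giving a good piece outside [Z]. *)
- move=> Z clZ UZ; apply: contrapT => nXZ.
  have [Y [W [compY clY clW nXW sub]]] := component_in_open clX clZ nXZ.
  have [YX irrY _] := compY.
  have fcY : {within Y, continuous f} by exact: continuous_subspaceW fc.
  have fPY x : Y x -> eval_at P x (f x) = 0 by move=> /YX; exact: fP.
  have [p [q [nq fq]]] := algebraic_rational_irreducible clY irrY fcY (nzP _ compY) fPY.
  pose Wq := W `|` [set x | ev q x = 0].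
  have clWq : zariski_closed Wq by apply: zariski_closedU => //; exact: zariski_closed1.
  (* Irreducibility of [Y] forbids covering it by [W] and the zeros of [q], neither of which
     contains [Y]. *)
  have [x [Xx nWqx]] : exists x, X x /\ ~ Wq x.
    apply: contrapT => H; have XWq x : X x -> Wq x.
      by move=> Xx; apply: contrapT => nWqx; apply: H; exists x.
    have [|YW|Yq] := irrY.2 W [set x | ev q x = 0] clW (zariski_closed1 q).
    - by move=> x /YX; exact: XWq.
    - apply: nXW => x Xx; apply: contrapT => nWx.
      by have [/YW] := sub x (conj Xx nWx).
    - exact: nq Yq.
  have XWY y : X y -> ~ Wq y -> Y y /\ ~ Z y.
    by move=> Xy nWqy; apply: sub; split=> // Wy; apply: nWqy; left.
  have [_ []] := XWY x Xx nWqx; apply: UZ; exists (X `\` Wq) => //.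
  split; first by exists Wq.
  exists p, q => y [Xy nWqy].
  have qy : ev q y != 0 by apply/eqP => qy; apply: nWqy; right.
  by split=> //; apply: fq => //; have [] := XWY y Xy nWqy.
- move=> x [V gV Vx]; have [oV [p [q pq]]] := gV.
  exists V, p, q; split=> // y Vy; by exists V.
Qed.
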